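(* Let $F=F(x)=\sum_{n\ge 1} f_n x^n$, where $f_n$ is the number of permutations of length $n$ in the class $F(321)$ of fractal $321$-avoiders, and let $A_i(t)=\sum_{n\ge 3} a_n t^n$, where $a_n$ is the number of absolutely irreducible $321$-avoiding permutations of length $n$. Then $$F^2+\bigl(A_i(F)-1+x\bigr)F+A_i(F)+x=0,$$ and $F$ satisfies the polynomial equation $$F^6+(-2x+3)F^4+(-2x-1)F^3+(-3x+3+x^2)F^2+(2x^2-1-2x)F+x+x^2=0 .$$
   Context: A permutation $\pi=p_1p_2\cdots p_m$ of $\{1,\dots,m\}$ is written in one-line notation. It avoids $321$ if there are no indices $i<j<k$ with $p_i>p_j>p_k$; $A(321)$ denotes the set of $321$-avoiding permutations. A subword of $\pi$ means a contiguous block of entries; it is proper if it is not all of $\pi$. A permutation of length $m$ is absolutely irreducible if it has no proper subword of length greater than $1$ whose set of values is an interval (set of consecutive integers) in $\{1,\dots,m\}$. The class $F(321)$ of fractal $321$-avoiders is the set of (nonempty) permutations defined recursively as follows (it is the smallest set with these closure properties): $\pi\in F(321)$ if either $\pi\in A(321)$, or $\pi=\alpha_1\alpha_2\cdots\alpha_c$ is a concatenation of nonempty subwords such that the values occurring in each $\alpha_i$ form an interval, the permutation order-isomorphic to each $\alpha_i$ is in $F(321)$, and the relative ordering of the $\alpha_i$ (by their values), interpreted as a permutation of length $c$, is in $A(321)$. Equivalently, $F(321)$ is the closure of $\{1\}$ under the operation of replacing an element of a permutation by a block (consecutive positions, values forming an interval, retaining the relative order with respect to the other elements) that is order-isomorphic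 to a $321$-avoiding permutation. *)

(* Defs.v *)
From HB Require Import structures.
From mathcomp Require Import all_boot all_order all_algebra.
From mathcomp Require Import boolp.

Set Implicit Arguments.
Unset Strict Implicit.
Unset Printing Implicit Defensive.

Import GRing.Theory.

(* A permutation of {1, ..., n} is its one-line notation, a [seq nat];
   all of them are listed by [permutations (iota 1 n)]. *)

Definition is_perm (w : seq nat) : bool := perm_eq w (iota 1 (size w)).

Definition is_interval (w : seq nat) : Prop :=
  exists m k : nat, w =i iota m k.

Definition avoids321 (w : seq nat) : Prop :=
  forall i j k : nat, i < j -> j < k -> k < size w ->
    ~ (nth 0 w j < nth 0 w i /\ nth 0 w k < nth 0 w j).

(* The permutation order-isomorphic to a word with distinct entries: each
   entry is replaced by its rank. *)
Definition std (w : seq nat) : seq nat :=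
  [seq count (fun y => y <= x) w | x <- w].

Definition abs_irreducible (w : seq nat) : Prop :=
  forall u v t : seq nat, w = u ++ v ++ t ->
    1 < size v -> size v < size w -> ~ is_interval v.

(* In [fractal_blocks] the blocks are nonempty and have pairwise disjoint
   intervals of values, so their relative order is that of their first
   entries. *)
Inductive fractal321 : seq nat -> Prop :=
| fractal_avoids (w : seq nat) :
    w <> [::] -> is_perm w -> avoids321 w -> fractal321 w
| fractal_blocks (bs : seq (seq nat)) :
    bs <> [::] ->
    is_perm (flatten bs) ->
    (forall b, b \in bs -> b <> [::]) ->
    (forall b, b \in bs -> is_interval b) ->
    (forall b, b \in bs -> fractal321 (std b)) ->
    avoids321 (std [seq head 0 b | b <- bs]) ->
    fractal321 (flatten bs).

Definition num_fractal321 (n : nat) : nat :=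
  count (fun w => `[< fractal321 w >]) (permutations (iota 1 n)).

Definition num_irreducible321 (n : nat) : nat :=
  count (fun w => `[< abs_irreducible w /\ avoids321 w >])
        (permutations (iota 1 n)).

Local Open Scope ring_scope.

Record fps (R : Type) := FPS { fcoef : nat -> R }.

Lemma fpsP (R : Type) (f g : fps R) : fcoef f =1 fcoef g -> f = g.
Proof. by case: f g => [f] [g] /= /funext ->. Qed.

HB.instance Definition _ (R : Type) := gen_eqMixin (fps R).
HB.instance Definition _ (R : Type) := gen_choiceMixin (fps R).

Definition fps_zero (R : comNzRingType) : fps R := FPS (fun=> 0).
Definition fps_one (R : comNzRingType) : fps R := FPS (fun n => (n == 0%N)%:R).
Definition fps_opp (R : comNzRingType) (f : fps R) : fps R :=
  FPS (fun n => - fcoef f n).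
Definition fps_add (R : comNzRingType) (f g : fps R) : fps R :=
  FPS (fun n => fcoef f n + fcoef g n).
Definition fps_mul (R : comNzRingType) (f g : fps R) : fps R :=
  FPS (fun n => \sum_(i < n.+1) fcoef f i * fcoef g (n - i)).

Definition fps_trunc (R : comNzRingType) (N : nat) (f : fps R) : {poly R} :=
  \poly_(i < N.+1) fcoef f i.

Lemma coef_fps_trunc (R : comNzRingType) (N : nat) (f : fps R) (i : nat) :
  (i <= N)%N -> (fps_trunc N f)`_i = fcoef f i.
Proof. by move=> iN; rewrite coef_poly ltnS iN. Qed.

Lemma fcoef_mul_poly (R : comNzRingType) (p q : {poly R}) (f g : fps R)
    (n : nat) :
  (forall i, (i <= n)%N -> p`_i = fcoef f i) ->
  (forall i, (i <= n)%N -> q`_i = fcoef g i) ->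
  fcoef (fps_mul f g) n = (p * q)`_n.
Proof.
move=> pf qg; rewrite coefM /=; apply: eq_bigr => i _.
by rewrite pf ?qg ?leq_subr // -ltnS.
Qed.

Lemma fps_addA (R : comNzRingType) : associative (@fps_add R).
Proof. by move=> f g h; apply: fpsP => n /=; rewrite addrA. Qed.

Lemma fps_addC (R : comNzRingType) : commutative (@fps_add R).
Proof. by move=> f g; apply: fpsP => n /=; rewrite addrC. Qed.

Lemma fps_add0 (R : comNzRingType) : left_id (fps_zero R) (@fps_add R).
Proof. by move=> f; apply: fpsP => n /=; rewrite add0r. Qed.

Lemma fps_addN (R : comNzRingType) :
  left_inverse (fps_zero R) (@fps_opp R) (@fps_add R).
Proof. by move=> f; apply: fpsP => n /=; rewrite addNr. Qed.

HB.instance Definition _ (R : comNzRingType) :=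
  GRing.isZmodule.Build (fps R)
    (@fps_addA R) (@fps_addC R) (@fps_add0 R) (@fps_addN R).

Lemma fps_mulA (R : comNzRingType) : associative (@fps_mul R).
Proof.
move=> f g h; apply: fpsP => n.
have trM (f1 f2 : fps R) i : (i <= n)%N ->
    (fps_trunc n f1 * fps_trunc n f2)`_i = fcoef (fps_mul f1 f2) i.
  by move=> le_in; rewrite (@fcoef_mul_poly _ (fps_trunc n f1) (fps_trunc n f2))
       // => j le_ji; rewrite coef_fps_trunc // (leq_trans le_ji).
rewrite (fcoef_mul_poly (@coef_fps_trunc _ n f) (trM g h)).
by rewrite (fcoef_mul_poly (trM f g) (@coef_fps_trunc _ n h)) mulrA.
Qed.

Lemma fps_mulC (R : comNzRingType) : commutative (@fps_mul R).
Proof.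
move=> f g; apply: fpsP => n.
rewrite (fcoef_mul_poly (@coef_fps_trunc _ n f) (@coef_fps_trunc _ n g)).
by rewrite (fcoef_mul_poly (@coef_fps_trunc _ n g) (@coef_fps_trunc _ n f)) mulrC.
Qed.

Lemma fps_mul1 (R : comNzRingType) : left_id (fps_one R) (@fps_mul R).
Proof.
move=> f; apply: fpsP => n.
rewrite (@fcoef_mul_poly _ 1 (fps_trunc n f)); last exact: coef_fps_trunc.
  by rewrite mul1r coef_fps_trunc.
by move=> i _; rewrite coef1.
Qed.

Lemma fps_mulD (R : comNzRingType) : left_distributive (@fps_mul R) (@fps_add R).
Proof.
move=> f g h; apply: fpsP => n /=; rewrite -big_split /=.
by apply: eq_bigr => i _; rewrite mulrDl.
Qed.

Lemma fps_one_neq0 (R : comNzRingType) : fps_one R != 0.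
Proof.
by apply/eqP => /(congr1 (fun f => fcoef f 0)) /eqP; rewrite /= oner_eq0.
Qed.

HB.instance Definition _ (R : comNzRingType) :=
  GRing.Zmodule_isComNzRing.Build (fps R)
    (@fps_mulA R) (@fps_mulC R) (@fps_mul1 R) (@fps_mulD R) (@fps_one_neq0 R).

Definition fpsX (R : comNzRingType) : fps R := FPS (fun n => (n == 1%N)%:R).

(* The substitution a(f), meaningful only when f has zero constant term: then
   f ^+ k does not contribute to the coefficient n for k > n, and the sum may
   stop at k = n. *)
Definition fps_comp (R : comNzRingType) (a f : fps R) : fps R :=
  FPS (fun n => \sum_(k < n.+1) fcoef a k * fcoef (f ^+ k) n).

Definition fractal_gf : fps int :=
  FPS (fun n => if (1 <= n)%N then (num_fractal321 n)%:Z else 0).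

(* Lengths 1 and 2 are excluded: there every permutation is absolutely
   irreducible. *)
Definition irreducible_gf : fps int :=
  FPS (fun n => if (3 <= n)%N then (num_irreducible321 n)%:Z else 0).

(* Main.v *)
Require Import Defs.
From mathcomp Require Import all_boot all_order all_algebra.
From mathcomp Require Import boolp zify ring.

Set Implicit Arguments.
Unset Strict Implicit.
Unset Printing Implicit Defensive.
Import GRing.Theory.

(** Read a permutation of length at least 2 as a diagram.  It is exactly one of
    three things: a sum (it can be cut into a left part lying below the right
    part), a skew sum (the left part lies above the right part), or the inflation
    of a simple permutation of length at least 3, i.e. of an absolutely irreducible
    one, by permutations placed in intervals.  In the last case the quotient and
    the blocks are determined by the permutation: any proper interval lies inside
    one block ([simple_factor]), which gives uniqueness
    ([simple_blocks_unique]), and cutting off greedily the longest proper interval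
    gives existence ([simple_blocks_exist]).  A sum is determined by its first
    sum-indecomposable component and by the rest, and likewise for skew sums.
    Hence a class whose membership can be read on these pieces has an equation for
    its generating function ([gf_cut], [gf_simple], [gf_decompose]).

    Let [S] be the series of the simple 321-avoiders of length at least 3.  The
    fractal class is closed under patterns ([fractal_pattern]); a sum or a skew sum
    is fractal iff both parts are, and a simple inflation is fractal iff its
    quotient avoids 321 and its blocks are fractal.  So
    [F = x + 2 F^2 / (1 + F) + S(F)], which is the first equation.

    The same decomposition applied to all 321-avoiders determines [S].  A skew sum
    avoids 321 iff both parts are increasing, and a simple inflation avoids 321 iff
    its quotient does and its blocks are increasing.  With [Y = x / (1 - x)] the
    series of increasing permutations, the series [I] of the sum-indecomposable
    321-avoiders is [x + Y^2 + S(Y)]; since 321-avoiders are counted by the Catalan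
    numbers ([catalan_avoid]), also [I^2 - I + x = 0].  The substitution
    [u = F / (1 + F)] turns [Y] into [F], so that [J = u + F^2 + S(F)] satisfies
    [J^2 - J + u = 0].  Eliminating [S(F)] between this relation and the first
    equation gives the polynomial equation. *)


(** * Convex subwords and words cut into blocks *)

(** For a subword of a permutation this says that its values form an interval.
    Relative convexity has the advantage of being defined for words of distinct
    entries that are not permutations, and of being preserved by order
    isomorphism. *)
Definition convex (w b : seq nat) : Prop :=
  forall x y z, x \in b -> y \in b -> z \in w -> x <= z <= y -> z \in b.

Definition heads (bs : seq (seq nat)) : seq nat := [seq head 0 b | b <- bs].

(** The list [bs] cuts the word [flatten bs], whose entries are distinct, into
    nonempty blocks of consecutive values.  The quotient is represented by the word
    [heads bs] of first entries. *)
Definition blocked (bs : seq (seq nat)) : Prop :=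
  [/\ uniq (flatten bs), forall b, b \in bs -> b <> [::]
    & forall b, b \in bs -> convex (flatten bs) b].

(** Absolute irreducibility, with convexity in place of intervals so that it can be
    read directly on the word of heads. *)
Definition simple_word (w : seq nat) : Prop :=
  forall u v t, w = u ++ v ++ t -> 1 < size v -> size v < size w ->
  ~ convex w v.

(** Positions in a word of distinct entries are compared through [index]: a factor
    contains every entry located between two of its entries. *)
Lemma factor_between (p v q : seq nat) (x y z : nat) :
  uniq (p ++ v ++ q) -> x \in v -> z \in v ->
  index x (p ++ v ++ q) <= index y (p ++ v ++ q) <= index z (p ++ v ++ q) ->
  y \in v.
Proof.
rewrite !cat_uniq => /and3P[_ dp /and3P[_ dq _]] xv zv.
have np t : t \in v -> t \in p = false.
  move=> tv; apply/negP => tp; move/hasPn: dp => /(_ t).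
  by rewrite mem_cat tv /= tp => /(_ isT).
rewrite !index_cat (np x xv) (np z zv) xv zv.
have := index_mem x v; have := index_mem z v; rewrite xv zv.
case: ifP => [yp|_]; first by have := index_mem y p; rewrite yp; lia.
by case: ifP => // _; lia.
Qed.

Lemma subseq_index (v w : seq nat) (x y : nat) :
  uniq w -> subseq v w -> x \in v -> y \in v ->
  (index x v < index y v) = (index x w < index y w).
Proof.
elim: w v => [|a w IH] [|b v] //= /andP[aw uw].
case: ifP => [/eqP ->|ba] sv.
  have av : a \notin v by apply: contra aw => /(mem_subseq sv).
  rewrite !inE ![a == _]eq_sym.
  case: eqP => [->|xa] //=; case: eqP => [->|ya] //= xv yv.
  by rewrite !ltnS; exact: IH.
move=> xv yv.
have xa : a != x by apply: contraNneq aw => ->; exact: (mem_subseq sv).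
have ya : a != y by apply: contraNneq aw => ->; exact: (mem_subseq sv).
rewrite (negbTE xa) (negbTE ya) ltnS.
exact: (IH (b :: v)).
Qed.

Lemma mem_heads (bs : seq (seq nat)) (bsP : blocked bs) (b : seq nat) :
  b \in bs -> head 0 b \in b.
Proof. by case: bsP => _ ne _ /ne; case: b => //= a b _; rewrite mem_head. Qed.

Lemma block_sub (bs : seq (seq nat)) (b : seq nat) :
  b \in bs -> {subset b <= flatten bs}.
Proof. by move=> bb x xb; apply/flattenP; exists b. Qed.

Lemma flatten_block_eq (bs : seq (seq nat)) (b c : seq nat) (x : nat) :
  uniq (flatten bs) -> b \in bs -> c \in bs -> x \in b -> x \in c -> b = c.
Proof.
elim: bs => //= a bs IH; rewrite cat_uniq !inE => /and3P[_ /hasPn d u].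
have dis e : e \in bs -> x \in e -> x \in a -> False.
  by move=> eb xe xa; move: (d x); rewrite xa => /(_ _)/negP; case=> //; apply/flattenP; exists e.
case/orP => [/eqP ->|bb]; case/orP => [/eqP ->|cb] // xb xc.
- by case: (dis c).
- by case: (dis b).
exact: IH.
Qed.

Lemma index_flatten_lt (bs : seq (seq nat)) (b c : seq nat) (x y : nat) :
  uniq (flatten bs) -> b \in bs -> c \in bs -> x \in b -> y \in c -> b <> c ->
  (index x (flatten bs) < index y (flatten bs)) = (index b bs < index c bs).
Proof.
move=> u0 b0 c0 xb yc bc.
elim: bs u0 b0 c0 => //= a bs IH u0; have := u0; rewrite cat_uniq => /and3P[_ _ u].
have h (e : seq nat) (t : nat) : e \in a :: bs -> t \in e -> (t \in a) = (a == e).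
  move=> eb te; apply/idP/eqP => [ta|-> //].
  by apply: (@flatten_block_eq (a :: bs) _ _ t) => //; rewrite mem_head.
move=> b0 c0; rewrite !index_cat (h b x) // (h c y) //.
case: eqP => [ab|ab]; case: eqP => [ac|ac].
- by case: bc; rewrite -ab.
- rewrite ltn0Sn; move: xb; rewrite -ab -index_mem; lia.
- rewrite ltn0; move: yc; rewrite -ac -index_mem; lia.
rewrite ltn_add2l ltnS; apply: IH => //.
  by move: b0; rewrite inE => /orP[/eqP/esym|].
by move: c0; rewrite inE => /orP[/eqP/esym|].
Qed.

Lemma flatten_blockK (bs : seq (seq nat)) (b : seq nat) :
  uniq (flatten bs) -> b \in bs -> [seq x <- flatten bs | x \in b] = b.
Proof.
move=> u bb; apply/esym/subseq_uniqP => //.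
elim: bs bb {u} => //= a bs IH; rewrite inE => /orP[/eqP ->|/IH h].
  exact: prefix_subseq.
exact: subseq_trans h (suffix_subseq _ _).
Qed.

Lemma heads_subseq (bs : seq (seq nat)) :
  (forall b, b \in bs -> b <> [::]) -> subseq (heads bs) (flatten bs).
Proof.
elim: bs => //= b bs IH ne.
have: b <> [::] by apply: ne; rewrite mem_head.
case: b ne => //= a b ne _; rewrite eqxx; apply: subseq_trans (suffix_subseq _ _).
by apply: IH => c cb; apply: ne; rewrite inE cb orbT.
Qed.

Lemma heads_uniq (bs : seq (seq nat)) : blocked bs -> uniq (heads bs).
Proof. by case=> u ne _; apply: subseq_uniq (heads_subseq ne) u. Qed.

Lemma blocked_uniq (bs : seq (seq nat)) : blocked bs -> uniq bs.
Proof. by move/heads_uniq/map_uniq. Qed.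

Lemma head_inj (bs : seq (seq nat)) (b c : seq nat) : blocked bs ->
  b \in bs -> c \in bs -> head 0 b = head 0 c -> b = c.
Proof.
move=> B bb cb e; have [u _ _] := B.
by apply: (flatten_block_eq u bb cb (mem_heads B bb)); rewrite e (mem_heads B cb).
Qed.

Lemma heads_index (bs : seq (seq nat)) (b c : seq nat) : blocked bs ->
  b \in bs -> c \in bs ->
  (index (head 0 b) (heads bs) < index (head 0 c) (heads bs))
  = (index b bs < index c bs).
Proof.
move=> B bb cb; have [u ne _] := B.
rewrite (subseq_index u (heads_subseq ne)) ?map_f //.
case: (b =P c) => [->|bc]; first by rewrite !ltnn.
exact: index_flatten_lt (mem_heads B bb) (mem_heads B cb) bc.
Qed.

(** Two disjoint convex sets compare as wholes: otherwise some entry of one of them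
    would lie between two entries of the other. *)
Lemma convex_disjoint_lt (w b c : seq nat) (x x' y y' : nat) :
  convex w b -> convex w c -> {subset b <= w} -> {subset c <= w} ->
  (forall t, t \in b -> t \in c -> False) ->
  x \in b -> x' \in b -> y \in c -> y' \in c -> x < y -> x' < y'.
Proof.
move=> cb cc sb sc dis xb x'b yc y'c xy; rewrite ltnNge; apply/negP => yx.
case: (leqP x y') => h.
  by apply: (dis y') => //; apply: (cb x x') => //; [exact: sc | rewrite h].
by apply: (dis x) => //; apply: (cc y' y) => //; [exact: sb | rewrite (ltnW h) (ltnW xy)].
Qed.

Lemma block_lt (bs : seq (seq nat)) (b c : seq nat) (x x' y y' : nat) :
  blocked bs -> b \in bs -> c \in bs -> b <> c ->
  x \in b -> x' \in b -> y \in c -> y' \in c -> (x < y) = (x' < y').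
Proof.
move=> B bb cb bc xb x'b yc y'c; have [u ne cv] := B.
have dis t : t \in b -> t \in c -> False.
  by move=> tb tc; exact: bc (flatten_block_eq u bb cb tb tc).
have sb := @block_sub _ b bb; have sc := @block_sub _ c cb.
by apply/idP/idP; apply: convex_disjoint_lt (cv b bb) (cv c cb) sb sc dis _ _ _ _.
Qed.

(** * Uniqueness of the blocks over a simple quotient *)

Lemma filter_prefix_closed (T : eqType) (a : pred T) (s : seq T) : uniq s ->
  (forall y z, y \in s -> z \in s -> index y s < index z s -> a z -> a y) ->
  exists s2, s = filter a s ++ s2.
Proof.
elim: s => [|x s IH] /= => [|/andP[xs us] h]; first by exists [::].
case: ifP => ax.
  case: IH => // [y z ys zs lt az|s2 e]; last by exists s2; rewrite /= -e.
  have nx t : t \in s -> x == t = false by move=> ts; apply: contraNF xs => /eqP ->.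
  by apply: (h y z) => //; rewrite ?inE ?ys ?zs ?orbT // !nx.
exists (x :: s); suff -> : filter a s = [::] by [].
apply/eqP; rewrite -[_ == _]negbK -has_filter; apply/hasPn => z zs.
apply: contraFN ax => az; apply: (h x z) => //; rewrite ?mem_head ?inE ?zs ?orbT //.
by rewrite eqxx; case: eqP xs => // ->; rewrite zs.
Qed.

Lemma filter_between_closed (T : eqType) (a : pred T) (s : seq T) : uniq s ->
  (forall x y z, x \in s -> y \in s -> z \in s ->
     index x s < index y s -> index y s < index z s -> a x -> a z -> a y) ->
  exists s1 s2, s = s1 ++ filter a s ++ s2.
Proof.
elim: s => [|x s IH] /= => [|/andP[xs us] h]; first by exists [::], [::].
have nx t : t \in s -> x == t = false by move=> ts; apply: contraNF xs => /eqP ->.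
case: ifP => ax.
  case: (@filter_prefix_closed T a s) => // [y z ys zs lt az|s2 e].
    by apply: (h x y z) => //; rewrite ?inE ?eqxx ?ys ?zs ?orbT // !nx.
  by exists [::], s2; rewrite /= -e.
case: IH => // [y z t ys zs ts l1 l2 ay at'|s1 [s2 e]].
  by apply: (h y z t) => //; rewrite ?inE ?ys ?zs ?ts ?orbT // !nx.
by exists (x :: s1), s2; rewrite /= -e.
Qed.

Lemma mem_headsP (bs : seq (seq nat)) (x : nat) :
  reflect (exists2 b, b \in bs & x = head 0 b) (x \in heads bs).
Proof. exact: mapP. Qed.

(** The blocks met by [v] are consecutive and have consecutive values, so by
    simplicity of the quotient [v] meets at most one block, or all of them.  In the
    second case let [z] be an entry outside [v], in the block [c].  No entry of [v]
    may surround [z] in position or in value, so [c] is first or last among the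
    blocks, and lowest or highest; then the other blocks, at least two in number,
    form a proper interval of the quotient, a contradiction. *)
Lemma simple_factor (bs : seq (seq nat)) (p v q : seq nat) :
  blocked bs -> simple_word (heads bs) -> 2 < size bs ->
  flatten bs = p ++ v ++ q -> convex (flatten bs) v ->
  size v < size (flatten bs) -> exists2 b, b \in bs & {subset v <= b}.
Proof.
move=> B simp sz e cv vsz; have [u ne cvb] := B; have ub := blocked_uniq B.
have [v0|[x0 x0v]] : v = [::] \/ exists x, x \in v.
  by case: v {e cv vsz} => [|x v]; [left | right; exists x; rewrite mem_head].
  by rewrite v0; case: bs sz {simp B u ne cvb ub e cv vsz} => // b bs _; exists b;
    rewrite ?mem_head.
have vw : {subset v <= flatten bs} by move=> x xv; rewrite e !mem_cat xv orbT.
pose meets (b : seq nat) := has [in v] b.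
have meetsP x b : x \in b -> x \in v -> meets b by move=> xb xv; apply/hasP; exists x.
have posv x y z : x \in v -> z \in v -> index x (flatten bs) < index y (flatten bs) ->
    index y (flatten bs) < index z (flatten bs) -> y \in v.
  move=> xv zv l1 l2; move: u; rewrite e => u; apply: (factor_between u xv zv).
  by rewrite -e (ltnW l1) (ltnW l2).
have [B1 [B3 eB]] : exists B1 B3, bs = B1 ++ filter meets bs ++ B3.
  apply: filter_between_closed => // b c d bb cb db l1 l2 /hasP[x xb xv] /hasP[z zd zv].
  have bc : b <> c by move=> E; move: l1; rewrite E ltnn.
  have cd : c <> d by move=> E; move: l2; rewrite E ltnn.
  apply: (meetsP (head 0 c)); rewrite ?(mem_heads B) //.
  apply: (posv x _ z) => //.
    by rewrite (index_flatten_lt u bb cb) ?(mem_heads B).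
  by rewrite (index_flatten_lt u cb db) ?(mem_heads B).
pose M := filter meets bs.
have cM : convex (heads bs) (heads M).
  move=> _ _ _ /mem_headsP[b + ->] /mem_headsP[d + ->] /mem_headsP[c cb ->].
  rewrite !mem_filter => /andP[mb bb] /andP[md db] /andP[l1 l2].
  apply: map_f; rewrite mem_filter cb andbT.
  have [<-//|bc] := eqVneq b c; have [->//|cd] := eqVneq c d.
  case/hasP: mb => x xb xv; case/hasP: md => z zd zv.
  apply: (meetsP (head 0 c)); rewrite ?(mem_heads B) //.
  apply: (cv x z) => //; first exact: block_sub (mem_heads B cb).
  have {}l1 : head 0 b < head 0 c.
    by rewrite ltn_neqAle l1 andbT; apply: contra_neq bc => /(head_inj B bb cb).
  have {}l2 : head 0 c < head 0 d.
    by rewrite ltn_neqAle l2 andbT; apply: contra_neq cd => /(head_inj B cb db).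
  move/eqP: bc => bc; move/eqP: cd => cd.
  rewrite (@block_lt bs b c (head 0 b) x (head 0 c) (head 0 c)) ?(mem_heads B) // in l1.
  rewrite (@block_lt bs c d (head 0 c) (head 0 c) (head 0 d) z) ?(mem_heads B) // in l2.
  by rewrite (ltnW l1) (ltnW l2).
have inM x : x \in v -> exists2 b, b \in M & x \in b.
  move=> xv; have /flattenP[b bb xb] := vw x xv.
  by exists b => //; rewrite mem_filter bb andbT; apply: meetsP xb xv.
case: (leqP (size M) 1) => sM1.
  have [b bM x0b] := inM _ x0v.
  have eM : M = [:: b] by move: bM sM1; case: (M) => [|c [|]] //; rewrite inE => /eqP ->.
  exists b; first by move: bM; rewrite mem_filter => /andP[].
  by move=> x /inM[c]; rewrite eM inE => /eqP ->.
have sbs : size (heads bs) = size bs by rewrite size_map.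
case: (ltnP (size M) (size bs)) => sM2.
  case: (simp (heads B1) (heads M) (heads B3)); rewrite ?size_map // /heads.
  by rewrite -!map_cat -eB.
have allm b : b \in bs -> meets b.
  move: sM2; rewrite /M size_filter => c.
  by apply/allP; rewrite all_count eqn_leq c count_size.
(* From here on every block meets v. *)
have [z zw zv] : exists2 z, z \in flatten bs & z \notin v.
  apply/hasP; rewrite has_predC; apply/negP => /allP h.
  by have := uniq_leq_size u h; rewrite leqNgt vsz.
have [c cb zc] := flattenP zw.
have npos b d : b \in bs -> d \in bs -> index b bs < index c bs ->
    index c bs < index d bs -> False.
  move=> bb db l1 l2; case/hasP: (allm b bb) => x xb xv; case/hasP: (allm d db) => y yd yv.
  have bc : b <> c by move=> E; move: l1; rewrite E ltnn.
  have cd : c <> d by move=> E; move: l2; rewrite E ltnn.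
  case/negP: zv; apply: (posv x _ y) => //.
    by rewrite (index_flatten_lt u bb cb).
  by rewrite (index_flatten_lt u cb db).
have nval b d : b \in bs -> d \in bs -> head 0 b < head 0 c -> head 0 c < head 0 d -> False.
  move=> bb db l1 l2; case/hasP: (allm b bb) => x xb xv; case/hasP: (allm d db) => y yd yv.
  have bc : b <> c by move=> E; move: l1; rewrite E ltnn.
  have cd : c <> d by move=> E; move: l2; rewrite E ltnn.
  rewrite (@block_lt bs b c (head 0 b) x (head 0 c) z) ?(mem_heads B) // in l1.
  rewrite (@block_lt bs c d (head 0 c) z (head 0 d) y) ?(mem_heads B) // in l2.
  by case/negP: zv; apply: (cv x y) => //; rewrite (ltnW l1) (ltnW l2).
have cvB D : (forall d, d \in D -> d \in bs) -> c \notin D ->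
    (forall d, d \in bs -> d = c \/ d \in D) -> convex (heads bs) (heads D).
  move=> sD cD h _ _ _ /mem_headsP[b bD ->] /mem_headsP[d dD ->] /mem_headsP[f fb ->].
  case: (h f fb) => [-> |fD _]; last exact: map_f.
  case/andP; rewrite leq_eqVlt => /orP[/eqP E|l1].
    by case/negP: cD; rewrite -(head_inj B _ cb E) // sD.
  rewrite leq_eqVlt => /orP[/eqP E|l2].
    by case/negP: cD; rewrite (head_inj B cb _ E) // sD.
  by case: (nval b d) => //; apply: sD.
have [D1 [D2 eD]] : exists D1 D2, bs = D1 ++ c :: D2.
  by case/splitPr: cb => D1 D2; exists D1, D2.
have [cD1 cD2] : c \notin D1 /\ c \notin D2.
  move: ub; rewrite eD cat_uniq /= negb_or.
  by case/and3P => _ /andP[-> _] /andP[-> _].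
have sD d : d \in D1 \/ d \in D2 -> d \in bs.
  by case=> h; rewrite eD mem_cat inE h ?orbT.
have Dall d : d \in bs -> [\/ d \in D1, d = c | d \in D2].
  rewrite eD mem_cat inE => /or3P[h|/eqP h|h]; by [constructor 1 | constructor 2 | constructor 3].
move: sz simp; rewrite eD size_cat /=.
case: (D1 =P [::]) => [D10|D1n].
  have cD : convex (heads bs) (heads D2).
    apply: cvB => // d; first by move=> h; apply: sD; right.
    by case/Dall; [rewrite D10 | left | right].
  move: cD; rewrite eD D10 => cD sz /(_ [:: head 0 c] (heads D2) [::]).
  by rewrite cats0 /= !size_map; case.
case: (D2 =P [::]) => [D20|D2n].
  have cD : convex (heads bs) (heads D1).
    apply: cvB => // d; first by move=> h; apply: sD; left.
    by case/Dall; [right | left | rewrite D20].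
  move: cD; rewrite eD D20 addn1 => cD sz /(_ [::] (heads D1) [:: head 0 c]).
  by rewrite /heads map_cat /= !size_cat /= size_map addn1; move: cD; rewrite /heads map_cat => cD; case.
case: D1 D1n eD cD1 sD {Dall} => // b D1 _ eD cD1 sD.
case: D2 D2n eD cD2 sD => // d D2 _ eD cD2 sD _ _.
have bb : b \in bs := sD b (or_introl (mem_head _ _)).
have db : d \in bs := sD d (or_intror (mem_head _ _)).
case: (npos b d) => //; rewrite eD !index_cat (negbTE cD1) ?mem_head.
  by rewrite (leq_trans _ (leq_addr _ _)) // index_mem mem_head.
have -> : d \in b :: D1 = false.
  move: ub; rewrite eD cat_uniq => /and3P[_ /hasPn h _].
  by apply/negbTE/h; rewrite !inE eqxx orbT.
by rewrite ltn_add2l /= eqxx; case: eqP cD2 => // ->; rewrite mem_head.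
Qed.

Lemma flatten_block_inj (bs cs : seq (seq nat)) :
  flatten bs = flatten cs -> uniq (flatten bs) ->
  (forall b, b \in bs -> b <> [::]) -> (forall c, c \in cs -> c <> [::]) ->
  (forall b, b \in bs -> exists2 c, c \in cs & {subset b <= c}) ->
  (forall c, c \in cs -> exists2 b, b \in bs & {subset c <= b}) -> bs = cs.
Proof.
elim: bs cs => [|b bs IH] [|c cs] //= e u nb nc bc cb.
- by move: e (nc c); rewrite mem_head; case: c {nc cb bc} => //= _ /(_ isT).
- by move: e (nb b); rewrite mem_head; case: b {nb cb bc u} => //= _ /(_ isT).
have uc : uniq (flatten (c :: cs)) by rewrite /= -e.
have [x [xb xc]] : exists x, x \in b /\ x \in c.
  have [bn cn] : b <> [::] /\ c <> [::] by split; [apply: nb | apply: nc]; rewrite mem_head.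
  case: b bn e {nb bc cb u} => // x b _; case: c cn {nc uc} => // y c _ [-> _].
  by exists y; rewrite !mem_head.
have sbc : {subset b <= c}.
  have [c' c'c s] := bc b (mem_head _ _).
  by rewrite (@flatten_block_eq (c :: cs) c c' x) // ?mem_head //; apply: s.
have scb : {subset c <= b}.
  have [b' b'b s] := cb c (mem_head _ _).
  by rewrite (@flatten_block_eq (b :: bs) b b' x) // ?mem_head //; apply: s.
have ebc : b = c.
  have : size b = size c.
    apply/eqP; rewrite eqn_leq !uniq_leq_size //.
      by move: uc; rewrite /= cat_uniq => /andP[].
    by move: u; rewrite cat_uniq => /andP[].
  by move=> h; have := congr1 (take (size b)) e; rewrite take_size_cat // h take_size_cat.
move: e; rewrite ebc => /eqP; rewrite eqseq_cat // eqxx /= => /eqP e.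
congr cons; apply: IH => //.
- by move: u; rewrite cat_uniq => /and3P[].
- by move=> d db; apply: nb; rewrite inE db orbT.
- by move=> d db; apply: nc; rewrite inE db orbT.
- move=> d db; have dbb : d \in b :: bs by rewrite inE db orbT.
  have [c' + s] := bc d dbb; rewrite inE => /orP[/eqP E|h]; last by exists c'.
  case: d db dbb s (nb d dbb) => // y d db dbb s _.
  have yc : y \in c by rewrite -E; apply: s; rewrite mem_head.
  have : uniq (b ++ flatten bs) := u; rewrite cat_uniq => /and3P[_ /hasPn /(_ y) h _].
  move: h; rewrite ebc yc => /(_ _)/negP; case=> //; apply/flattenP.
  by exists (y :: d); rewrite ?mem_head.
move=> d db; have dbb : d \in c :: cs by rewrite inE db orbT.
have [c' + s] := cb d dbb; rewrite inE => /orP[/eqP E|h]; last by exists c'.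
case: d db dbb s (nc d dbb) => // y d db dbb s _.
have yc : y \in c by rewrite -ebc -E; apply: s; rewrite mem_head.
move: uc; rewrite /= cat_uniq => /and3P[_ /hasPn /(_ y) h _].
move: h; rewrite yc => /(_ _)/negP; case=> //; apply/flattenP.
by exists (y :: d); rewrite ?mem_head.
Qed.

Lemma block_factor (bs : seq (seq nat)) (b : seq nat) : b \in bs ->
  exists p q, flatten bs = p ++ b ++ q.
Proof.
by case/splitPr=> s1 s2; exists (flatten s1), (flatten s2); rewrite flatten_cat.
Qed.

Lemma block_proper (bs : seq (seq nat)) (b : seq nat) : 1 < size bs ->
  (forall b, b \in bs -> b <> [::]) -> b \in bs -> size b < size (flatten bs).
Proof.
move=> sz ne bb.
have [s1 [s2 e]] : exists s1 s2 : seq (seq nat), bs = s1 ++ b :: s2.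
  by case/splitPr: bb => s1 s2; exists s1, s2.
move: sz ne; rewrite e size_cat /= => sz ne.
rewrite flatten_cat size_cat /= size_cat.
have pos (s : seq (seq nat)) : 0 < size s -> {subset s <= s1 ++ b :: s2} ->
    0 < size (flatten s).
  case: s => //= a s _ h; rewrite size_cat.
  have : a <> [::] by apply/ne/h; rewrite mem_head.
  by case: a {h}.
have [h|h] : 0 < size s1 \/ 0 < size s2 by lia.
  suff : 0 < size (flatten s1) by lia.
  by apply: pos h _ => x xs; rewrite mem_cat xs.
suff : 0 < size (flatten s2) by lia.
by apply: pos h _ => x xs; rewrite mem_cat inE xs !orbT.
Qed.

Lemma simple_blocks_unique (bs cs : seq (seq nat)) :
  blocked bs -> blocked cs -> flatten bs = flatten cs ->
  simple_word (heads bs) -> simple_word (heads cs) ->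
  2 < size bs -> 2 < size cs -> bs = cs.
Proof.
move=> B C e sb sc szb szc; have [u nb cb] := B; have [uc nc cc] := C.
apply: flatten_block_inj => // [b bb|c cC].
  have [p [q E]] := block_factor bb.
  apply: (@simple_factor cs p b q) => //; rewrite -?e //; first exact: cb.
  by apply: block_proper => //; apply: ltnW.
have [p [q E]] := block_factor cC.
apply: (@simple_factor bs p c q) => //; rewrite ?e //; first exact: cc.
by apply: block_proper => //; apply: ltnW.
Qed.

(** * Existence of the blocks *)

(** Sum-decomposable for [d = true], skew-decomposable for [d = false]. *)
Definition decomposable (d : bool) (w : seq nat) : Prop :=
  exists u v, [/\ w = u ++ v, u <> [::], v <> [::]
    & forall x y, x \in u -> y \in v -> if d then x < y else y < x].

Lemma convex1 (w : seq nat) (x : nat) : convex w [:: x].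
Proof.
move=> a b c; rewrite !inE => /eqP -> /eqP -> _ h.
by rewrite eqn_leq andbC.
Qed.

(** From left to right, each block is the longest convex subword starting there
    among those shorter than [w].  The last clause records this maximality: a longer
    convex subword with the same starting point has the length of [w]. *)
Lemma greedy_blocks (w : seq nat) : 1 < size w ->
  forall s p : seq nat, w = p ++ s -> exists bs : seq (seq nat),
  [/\ flatten bs = s,
      forall b, b \in bs -> [/\ b <> [::], convex w b & size b < size w]
    & forall (bs1 bs2 : seq (seq nat)) (b c t : seq nat),
        bs = bs1 ++ b :: bs2 -> b ++ flatten bs2 = c ++ t -> convex w c ->
        size b < size c -> size c = size w].
Proof.
move=> w1 s; have [n] := ubnP (size s); elim: n s => // n IH [|x s] sn p e.
  by exists [::]; split=> // [[]].
pose P k := [&& 0 < k, k <= size (x :: s), `[< convex w (take k (x :: s)) >] & k < size w].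
have P1 : P 1 by rewrite /P w1 /= andbT take0; apply/asboolP/convex1.
have [k /and4P[k0 ks /asboolP ck kw] kmax] := @ex_maxnP P (size (x :: s)) (ex_intro _ 1 P1)
  (fun k h => let: And4 _ h _ _ := and4P h in h).
have [] := IH (drop k (x :: s)) _ (p ++ take k (x :: s)).
- by rewrite size_drop; move: sn k0 ks => /=; lia.
- by rewrite -catA cat_take_drop.
move=> bs [e1 h1 h2]; exists (take k (x :: s) :: bs); split.
- by rewrite [flatten _]/= e1 cat_take_drop.
- move=> b; rewrite inE => /orP[/eqP ->|]; last exact: h1.
  by split=> //; [case: (k) k0 | rewrite size_takel].
move=> [|b1 bs1] bs2 b c t /= [].
  move=> <- <-; rewrite e1 cat_take_drop => ec cc; rewrite size_takel // => kc.
  have lc : size c <= size (x :: s) by rewrite ec size_cat leq_addr.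
  have lw : size c <= size w by rewrite e size_cat; lia.
  apply/eqP; rewrite eqn_leq lw leqNgt /=; apply/negP => lt.
  have /kmax : P (size c).
    rewrite /P lc lt (leq_ltn_trans _ kc) //= andbT; apply/asboolP.
    by rewrite ec take_size_cat.
  by rewrite leqNgt kc.
by move=> _; apply: h2.
Qed.

(** An entry between two blocks in value belongs to a block between them. *)
Lemma convex_flatten (bs cs : seq (seq nat)) : blocked bs ->
  {subset cs <= bs} -> convex (heads bs) (heads cs) ->
  convex (flatten bs) (flatten cs).
Proof.
move=> B sub cv x y z /flattenP[b bc xb] /flattenP[d dc yd] /flattenP[c cb zc].
case/andP; rewrite leq_eqVlt => /orP[/eqP <- _|l1]; first by apply/flattenP; exists b.
rewrite leq_eqVlt => /orP[/eqP ->|l2]; first by apply/flattenP; exists d.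
apply/flattenP; exists c => //.
have bb := sub b bc; have db := sub d dc.
have [->//|/eqP nbc] := eqVneq c b; have [->//|/eqP ncd] := eqVneq c d.
rewrite (block_lt B bb cb _ xb (mem_heads B bb) zc (mem_heads B cb)) in l1; last first.
  by move/esym.
rewrite (block_lt B cb db _ zc (mem_heads B cb) yd (mem_heads B db)) // in l2.
have /mem_headsP[c' c'c E] : head 0 c \in heads cs.
  apply: (cv (head 0 b) (head 0 d)); rewrite ?map_f //.
  by rewrite (ltnW l1) (ltnW l2).
by rewrite (head_inj B cb (sub c' c'c) E).
Qed.

(** A proper interval of at least two greedy blocks would be a proper convex
    subword longer than the first of these blocks, against maximality, so the
    quotient is simple.  One block alone is excluded because blocks are proper, and
    two blocks would make [w] a sum or a skew sum. *)
Lemma simple_blocks_exist (w : seq nat) : uniq w -> 1 < size w ->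
  (forall d, ~ decomposable d w) ->
  exists bs, [/\ blocked bs, flatten bs = w, 2 < size bs & simple_word (heads bs)].
Proof.
move=> u w1 nd; have [bs [e h1 h2]] := greedy_blocks w1 (erefl : w = [::] ++ w).
have B : blocked bs.
  split; rewrite ?e // => b /h1[] // _; by rewrite e.
exists bs; split=> //.
  case: bs e h1 B {h2} => [|b [|c [|? ?]]] //=.
  - by move=> e0; move: w1; rewrite -e0.
  - by rewrite cats0 => <- /(_ b); rewrite mem_head ltnn => /(_ isT)[].
  rewrite cats0 => e h B.
  have [bn bcv bsz] := h b (mem_head _ _).
  have cb : c \in [:: b; c] by rewrite !inE eqxx orbT.
  have [cn ccv csz] := h c cb.
  have nbc : b <> c.
    move=> E; move: u; rewrite -e E cat_uniq => /and3P[_ /hasPn hh _].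
    by case: (c) cn hh => // y s _ /(_ y); rewrite mem_head => /(_ isT).
  have hb := mem_heads B (mem_head _ _); have hc := mem_heads B cb.
  (* Two blocks: compare them through their heads. *)
  have [l|l] := ltnP (head 0 b) (head 0 c).
    case: (nd true); exists b, c; split=> // x y xb yc.
    by rewrite (block_lt B _ cb nbc xb hb yc hc) // mem_head.
  case: (nd false); exists b, c; split=> // x y xb yc.
  rewrite (block_lt B cb _ (nesym nbc) yc hc xb hb) ?mem_head //.
  rewrite ltn_neqAle l andbT; apply/eqP => /(head_inj B cb (mem_head _ _)).
  exact: nesym.
move=> s v t ev v1 vsz cv.
have [B1 [B2 [B3 [eB eu eV]]]] : exists B1 B2 B3 : seq (seq nat),
   [/\ bs = B1 ++ B2 ++ B3, s = heads B1 & v = heads B2].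
  exists (take (size s) bs), (take (size v) (drop (size s) bs)),
    (drop (size v) (drop (size s) bs)).
  rewrite !cat_take_drop /heads !(map_take, map_drop) -/(heads bs) ev.
  by rewrite take_size_cat // drop_size_cat // take_size_cat.
have sub : {subset B2 <= bs} by move=> x; rewrite eB !mem_cat => ->; rewrite orbT.
have cv2 : convex w (flatten B2).
  by rewrite -e; apply: convex_flatten; rewrite -?eV.
have [b [B2' eB2]] : exists b B2', B2 = b :: B2'.
  by case: (B2) eV v1 => [-> //|b B2' _ _]; exists b, B2'.
have ne x : x \in bs -> 0 < size x by case/h1; case: x.
(* B2 starts where its first block starts and is longer than it. *)
have E : size (flatten B2) = size w.
  apply: (h2 B1 (B2' ++ B3) b (flatten B2) (flatten B3)) => //.
  - by rewrite eB eB2.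
  - by rewrite eB2 /= flatten_cat catA.
  rewrite eB2 /= size_cat -addn1 leq_add2l.
  move: v1; rewrite eV size_map eB2 /=; case: (B2') eB2 => //= c B4 E _.
  rewrite size_cat; suff: 0 < size c by lia.
  by apply/ne/sub; rewrite E !inE eqxx orbT.
move: E; rewrite -e eB !flatten_cat !size_cat => E.
have nil (C : seq (seq nat)) : {subset C <= bs} -> size (flatten C) = 0 -> C = [::].
  case: C => //= c C sC; rewrite size_cat => /eqP; rewrite addn_eq0 => /andP[/eqP c0 _].
  by have := ne c (sC c (mem_head _ _)); rewrite c0.
have E1 : B1 = [::].
  by apply: nil; [move=> x; rewrite eB !mem_cat => -> | lia].
have E3 : B3 = [::].
  by apply: nil; [move=> x; rewrite eB !mem_cat => ->; rewrite !orbT | lia].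
by move: vsz; rewrite size_map eB E1 E3 cats0 /= eV size_map ltnn.
Qed.

(** * Standardization and order isomorphism *)

(** Every order isomorphism between words is handled as [map f] for such an [f]; the
    standardization is the case [f = rank w]. *)
Definition mono_on (w : seq nat) (f : nat -> nat) : Prop :=
  forall x y, x \in w -> y \in w -> (f x < f y) = (x < y).

Definition rank (w : seq nat) (x : nat) : nat := count (fun y => y <= x) w.

Lemma stdE (w : seq nat) : std w = [seq rank w x | x <- w].
Proof. by []. Qed.

Lemma size_std (w : seq nat) : size (std w) = size w.
Proof. exact: size_map. Qed.

Lemma std_nil (w : seq nat) : (std w = [::]) <-> (w = [::]).
Proof. by case: w. Qed.

Section Mono.

Variables (w : seq nat) (f : nat -> nat).
Hypothesis fP : mono_on w f.

Lemma mono_le (x y : nat) : x \in w -> y \in w -> (f x <= f y) = (x <= y).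
Proof. by move=> xw yw; rewrite leqNgt fP // -leqNgt. Qed.

Lemma mono_inj (x y : nat) : x \in w -> y \in w -> f x = f y -> x = y.
Proof. by move=> xw yw e; apply/eqP; rewrite eqn_leq -(mono_le xw yw) -(mono_le yw xw) e leqnn. Qed.

Lemma mono_sub (v : seq nat) : {subset v <= w} -> mono_on v f.
Proof. by move=> s x y /s xw /s yw; apply: fP. Qed.

Lemma uniq_mono : uniq [seq f x | x <- w] = uniq w.
Proof.
apply/idP/idP => [/map_uniq //|u]; rewrite map_inj_in_uniq // => x y.
exact: mono_inj.
Qed.

Lemma std_mono : std [seq f x | x <- w] = std w.
Proof.
rewrite !stdE -map_comp; apply/eq_in_map => x xw /=.
by rewrite /rank count_map; apply: eq_in_count => y yw /=; exact: mono_le.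
Qed.

Lemma convex_mono (b : seq nat) : {subset b <= w} ->
  convex [seq f x | x <- w] [seq f x | x <- b] <-> convex w b.
Proof.
move=> s; split=> c.
  move=> x y z xb yb zw h.
  have /mapP[z' z'b E] : f z \in [seq f x | x <- b].
    by apply: (c (f x) (f y)); rewrite ?map_f // !mono_le // s.
  by rewrite (mono_inj zw (s _ z'b) E).
move=> _ _ _ /mapP[x xb ->] /mapP[y yb ->] /mapP[z zw ->].
have [xw yw] := (s _ xb, s _ yb).
by rewrite !mono_le // => h; apply: map_f; exact: (c x y).
Qed.

Lemma map_eq_cat (v u1 u2 : seq nat) : [seq f x | x <- v] = u1 ++ u2 ->
  exists v1 v2, [/\ v = v1 ++ v2, u1 = [seq f x | x <- v1] & u2 = [seq f x | x <- v2]].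
Proof.
move=> e; exists (take (size u1) v), (drop (size u1) v).
by rewrite cat_take_drop map_take map_drop e take_size_cat // drop_size_cat.
Qed.

Lemma simple_mono : simple_word [seq f x | x <- w] <-> simple_word w.
Proof.
split=> s u v t e l1 l2.
  have vw : {subset v <= w} by move=> x xv; rewrite e !mem_cat xv orbT.
  have := s (map f u) (map f v) (map f t).
  by rewrite -!map_cat -e !size_map convex_mono //; apply.
have [u' [q [e1 eu /esym eq]]] := map_eq_cat e.
have [v' [t' [e2 ev et]]] := map_eq_cat eq.
move: l1 l2; rewrite ev !size_map => l1 l2.
rewrite convex_mono => [|x xv]; last by rewrite e1 e2 !mem_cat xv orbT.
by apply: (s u' v' t') => //; rewrite e1 e2.
Qed.

Lemma decomposable_mono (d : bool) :
  decomposable d [seq f x | x <- w] <-> decomposable d w.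
Proof.
split=> -[u [v [e nu nv h]]].
  have [u' [v' [e1 eu ev]]] := map_eq_cat e.
  exists u', v'; split=> //.
  - by move=> E; apply: nu; rewrite eu E.
  - by move=> E; apply: nv; rewrite ev E.
  move=> x y xu yv; have := h (f x) (f y); rewrite eu ev !map_f // => /(_ isT isT).
  have [xw yw] : x \in w /\ y \in w by rewrite e1 !mem_cat xu yv orbT.
  by case: (d); rewrite fP.
exists [seq f x | x <- u], [seq f x | x <- v]; split.
- by rewrite e map_cat.
- by case: (u) nu.
- by case: (v) nv.
move=> _ _ /mapP[x xu ->] /mapP[y yv ->].
have [xw yw] : x \in w /\ y \in w by rewrite e !mem_cat xu yv orbT.
by rewrite !fP //; apply: h.
Qed.

Lemma index_mono (v : seq nat) (x : nat) : {subset v <= w} -> x \in w ->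
  index (f x) [seq f x | x <- v] = index x v.
Proof.
elim: v => //= y v IH s xw.
have yw : y \in w by apply: s; rewrite mem_head.
have -> : (f y == f x) = (y == x).
  by apply/eqP/eqP => [/mono_inj|->] //; apply.
by rewrite IH // => z zv; apply: s; rewrite inE zv orbT.
Qed.

End Mono.

(** Avoidance in terms of entries and their positions, which is stable under
    subwords and order isomorphisms. *)
Lemma avoidsP (w : seq nat) : uniq w -> avoids321 w <->
  (forall x y z, x \in w -> y \in w -> z \in w -> index x w < index y w ->
     index y w < index z w -> y < x -> z < y -> False).
Proof.
move=> u; split=> [a x y z xw yw zw l1 l2 yx zy|a i j k ij jk kw [l1 l2]].
  by apply: (a _ _ _ l1 l2); rewrite ?index_mem // !nth_index.
have jw := ltn_trans jk kw; have iw := ltn_trans ij jw.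
by apply: (a (nth 0 w i) (nth 0 w j) (nth 0 w k)); rewrite ?mem_nth ?index_uniq.
Qed.

Lemma avoids_subseq (v w : seq nat) : uniq w -> subseq v w ->
  avoids321 w -> avoids321 v.
Proof.
move=> u s; have uv := subseq_uniq s u; rewrite !avoidsP // => a x y z xv yv zv.
rewrite !(subseq_index u s) // => l1 l2.
by apply: (a x y z) => //; apply: (mem_subseq s).
Qed.

Lemma avoids_mono (w : seq nat) (f : nat -> nat) : uniq w -> mono_on w f ->
  avoids321 [seq f x | x <- w] <-> avoids321 w.
Proof.
move=> u fP; have uf : uniq [seq f x | x <- w] by rewrite uniq_mono.
rewrite !avoidsP //; split=> a.
  move=> x y z xw yw zw; have := a (f x) (f y) (f z).
  by rewrite !map_f // !(index_mono fP) // !fP // => h l1 l2 l3 l4; apply: h.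
move=> _ _ _ /mapP[x xw ->] /mapP[y yw ->] /mapP[z zw ->].
by rewrite !(index_mono fP) // !fP //; apply: a.
Qed.

Lemma rank_mono (w : seq nat) : mono_on w (rank w).
Proof.
have lt x y : x \in w -> y \in w -> x < y -> rank w x < rank w y.
  move=> xw yw xy.
  have -> : rank w y = rank w x + count (fun z => x < z <= y) w.
    rewrite /rank -count_predUI.
    rewrite (@eq_count _ (predU _ _) (fun z => z <= y)); last by move=> z /=; lia.
    by rewrite (@eq_count _ (predI _ _) pred0) ?count_pred0 ?addn0 // => z /=; lia.
  by rewrite -addn1 leq_add2l -has_count; apply/hasP; exists y => //; rewrite xy leqnn.
move=> x y xw yw; apply/idP/idP; last exact: lt.
apply: contraTT; rewrite -!leqNgt leq_eqVlt => /orP[/eqP ->|/(lt _ _ yw xw) /ltnW //].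
by [].
Qed.

Lemma is_permP (w : seq nat) :
  is_perm w <-> uniq w /\ (forall x, x \in w -> 0 < x <= size w).
Proof.
rewrite /is_perm; split=> [h|[u h]].
  split=> [|x]; first by rewrite (perm_uniq h) iota_uniq.
  by rewrite (perm_mem h) mem_iota; lia.
have s : {subset w <= iota 1 (size w)} by move=> x /h; rewrite mem_iota; lia.
have := uniq_min_size u s; rewrite size_iota leqnn => /(_ isT) [_ e].
by apply: uniq_perm => //; exact: iota_uniq.
Qed.

Lemma perm_mem_range (w : seq nat) (x : nat) : is_perm w ->
  (x \in w) = (0 < x <= size w).
Proof. by move=> h; rewrite (perm_mem h) mem_iota; lia. Qed.

Lemma std_perm (w : seq nat) : uniq w -> is_perm (std w).
Proof.
move=> u; apply/is_permP; rewrite size_std; split.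
  by rewrite (uniq_mono (@rank_mono w)).
move=> _ /mapP[x xw ->]; rewrite count_size andbT -has_count.
by apply/hasP; exists x.
Qed.

Lemma rank_perm (w : seq nat) (x : nat) : is_perm w -> x \in w -> rank w x = x.
Proof.
move=> h xw; rewrite /rank; have /seq.permP -> := h.
have xs : x <= size w by move: xw; rewrite perm_mem_range //; lia.
rewrite -(subnKC xs) iotaD count_cat.
rewrite (_ : count _ _ = x); last first.
  rewrite -[RHS](size_iota 1 x) -[RHS]count_predT; apply: eq_in_count => y.
  by rewrite mem_iota /=; lia.
rewrite (@eq_in_count _ _ pred0) ?count_pred0 ?addn0 // => y.
by rewrite mem_iota /=; lia.
Qed.

Lemma std_of_perm (w : seq nat) : is_perm w -> std w = w.
Proof. by move=> h; rewrite stdE map_id_in // => x; apply: rank_perm. Qed.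

Lemma interval_convex (w b : seq nat) : is_perm w -> {subset b <= w} ->
  is_interval b <-> convex w b.
Proof.
move=> pw s; split=> [[m [k e]] x y z|c].
  by rewrite !e !mem_iota => xb yb _; lia.
case: b s c => [|x0 b] s c; first by exists 0, 0.
set v := x0 :: b in s c *.
have hm : exists x, x \in v by exists x0; rewrite mem_head.
have bd x : x \in v -> x <= size w by move/s; rewrite perm_mem_range //; case/andP.
have [m mv mmin] := ex_minnP hm; have [M Mv Mmax] := ex_maxnP hm bd.
exists m, (M.+1 - m) => z; rewrite mem_iota; apply/idP/idP => [zv|h].
  by have := mmin z zv; have := Mmax z zv; lia.
apply: (c m M) => //; last by lia.
by have := s m mv; have := s M Mv; rewrite !perm_mem_range //; lia.
Qed.

Lemma abs_irreducibleP (w : seq nat) : is_perm w ->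
  abs_irreducible w <-> simple_word w.
Proof.
move=> pw; split=> h u v t e l1 l2 hv; apply: (h u v t e l1 l2);
  apply/(interval_convex pw) => // x xv; by rewrite e !mem_cat xv orbT.
Qed.

(** * Inflation: the permutation with given quotient and blocks *)

(** The relative order of the blocks, and the permutations order-isomorphic to
    them. *)
Definition pattern (bs : seq (seq nat)) : seq nat * seq (seq nat) :=
  (std (heads bs), [seq std b | b <- bs]).

(** The pairs in [Z] consist of an entry of the quotient and the block that inflates
    it; this is the total size of the blocks below the entry [s]. *)
Definition offset (Z : seq (nat * seq nat)) (s : nat) : nat :=
  \sum_(p <- Z | p.1 < s) size p.2.

Definition inflate (e : seq nat * seq (seq nat)) : seq (seq nat) :=
  let Z := zip e.1 e.2 in
  [seq [seq offset Z p.1 + t | t <- p.2] | p <- Z].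

(** An entry of a permutation is the number of entries that do not exceed it.  For
    an entry of a block [b], these are the entries of the lower blocks, which the
    offset counts, and those of [b] itself, which the rank in [b] counts. *)
Lemma inflate_pattern (bs : seq (seq nat)) : blocked bs ->
  is_perm (flatten bs) -> inflate (pattern bs) = bs.
Proof.
move=> B pw; have ub := blocked_uniq B.
rewrite /inflate /pattern /= stdE /heads -map_comp zip_map -map_comp.
apply: map_id_in => b bb /=; rewrite stdE -map_comp; apply: map_id_in => x xb /=.
rewrite /offset big_map /=.
rewrite -[RHS](rank_perm pw); last exact: (block_sub bb).
rewrite /rank count_flatten sumnE big_map -/(heads bs) -!/(rank _ _).
rewrite [RHS](bigD1_seq b) //= addnC; congr addn.
rewrite big_mkcond (bigD1_seq b) //= ltnn add0n.
rewrite big_seq_cond [RHS]big_seq_cond; apply: eq_bigr => c /andP[cb /eqP ncb].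
rewrite rank_mono ?map_f // size_std.
have cmp y : y \in c -> (head 0 c < head 0 b) = (y < x).
  by move=> yc; exact: (block_lt B cb bb ncb (mem_heads B cb) yc (mem_heads B bb) xb).
case: ifP => l.
  rewrite /rank -(count_predT c); apply: eq_in_count => y yc /=.
  by rewrite ltnW // -(cmp y yc).
rewrite /rank (@eq_in_count _ _ pred0) ?count_pred0 // => y yc /=.
have := cmp y yc; rewrite l => /esym/negbT; rewrite -leqNgt => xy.
apply/negbTE; rewrite -ltnNge ltn_neqAle xy andbT; apply/eqP => E.
have [u _ _] := B.
by apply: ncb; apply: (flatten_block_eq u cb bb yc); rewrite -E.
Qed.

Definition good_pattern (e : seq nat * seq (seq nat)) : Prop :=
  [/\ is_perm e.1, size e.1 = size e.2
    & forall t, t \in e.2 -> is_perm t /\ t <> [::]].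

Section Inflate.

Variable e : seq nat * seq (seq nat).
Hypothesis eP : good_pattern e.

Let Z := zip e.1 e.2.

Let Z_unzip1 : unzip1 Z = e.1.
Proof. by case: eP => _ sz _; rewrite unzip1_zip // sz. Qed.

Let Z_unzip2 : unzip2 Z = e.2.
Proof. by case: eP => _ sz _; rewrite unzip2_zip // sz. Qed.

Let uniq1 : uniq (unzip1 Z).
Proof. by rewrite Z_unzip1; case: eP => /is_permP[]. Qed.

Let uniqZ : uniq Z. Proof. exact: map_uniq uniq1. Qed.

Let Zinj p q : p \in Z -> q \in Z -> p.1 = q.1 -> p = q.
Proof.
move=> pZ qZ; move: uniq1; rewrite /unzip1 => u E.
have : index p.1 (unzip1 Z) = index q.1 (unzip1 Z) by rewrite E.
have idx r : r \in Z -> index r.1 (unzip1 Z) = index r Z.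
  move=> rZ; rewrite -{1}(nth_index p rZ) -(nth_map _ 0) ?index_mem //.
  by rewrite index_uniq ?size_map ?index_mem.
by rewrite !idx // => h; rewrite -(nth_index p pZ) h nth_index.
Qed.

Let Z2 p : p \in Z -> is_perm p.2 /\ p.2 <> [::].
Proof. by case: eP => _ _ h pZ; apply: h; rewrite -Z_unzip2; apply: map_f. Qed.

Let off := offset Z.

Let off_size p : p \in Z -> off p.1 + size p.2 = \sum_(r <- Z | r.1 <= p.1) size r.2.
Proof.
move=> pZ; rewrite [RHS]big_mkcond [RHS](bigD1_seq p) //= leqnn addnC; congr addn.
rewrite /off /offset big_mkcond (bigD1_seq p) //= ltnn add0n.
rewrite big_seq_cond [RHS]big_seq_cond; apply: eq_bigr => r /andP[rZ /eqP nr].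
rewrite [in RHS]leq_eqVlt; case: eqP => // E.
by case: nr; apply: Zinj.
Qed.

Let off_lt p q : p \in Z -> q \in Z -> p.1 < q.1 -> off p.1 + size p.2 <= off q.1.
Proof.
move=> pZ qZ lt; rewrite off_size // /off /offset big_mkcond [leqRHS]big_mkcond /=.
apply: leq_sum => r _; case: ifP => // l.
by rewrite (leq_ltn_trans l lt).
Qed.

Let total := sumn [seq size t | t <- e.2].

Let off_total p : p \in Z -> off p.1 + size p.2 <= total.
Proof.
move=> pZ; rewrite off_size // /total -Z_unzip2 -map_comp sumnE big_map big_mkcond /=.
by apply: leq_sum => r _; case: ifP.
Qed.

Let Z2_mem p t : p \in Z -> (t \in p.2) = (0 < t <= size p.2).
Proof. by case/Z2 => h _; rewrite perm_mem_range. Qed.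

Lemma size_inflate : size (flatten (inflate e)) = total.
Proof.
rewrite size_flatten /shape /inflate -map_comp -/Z /total -Z_unzip2 -map_comp.
by congr sumn; apply: eq_map => p /=; rewrite size_map.
Qed.

Let block p := [seq off p.1 + t | t <- p.2].

Let mem_block p x : p \in Z ->
  (x \in block p) = (off p.1 < x <= off p.1 + size p.2).
Proof.
move=> pZ; apply/mapP/idP => [[t + ->]|h].
  by rewrite Z2_mem //; move: (off p.1) (size p.2) => o s; lia.
exists (x - off p.1); last by move: h; move: (off p.1) (size p.2) => o s; lia.
by rewrite Z2_mem //; move: h; move: (off p.1) (size p.2) => o s; lia.
Qed.

Let block_cmp p q x y : p \in Z -> q \in Z -> p.1 < q.1 ->
  x \in block p -> y \in block q -> x < y.
Proof.
move=> pZ qZ lt; rewrite !mem_block // => h1 h2.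
by have := off_lt pZ qZ lt; lia.
Qed.

Let uniq_inflate : uniq (flatten (inflate e)).
Proof.
apply: allpairs_uniq_dep => // [p pZ|]; first by have [/is_permP[]] := Z2 pZ.
move=> [p t] [q s] /allpairsPdep[p' [t' [pZ tp [-> ->]]]] /allpairsPdep[q' [s' [qZ sq [-> ->]]]] /= E.
have {}E : off p'.1 + t' = off q'.1 + s' := E.
have bp : off p'.1 + t' \in block p' by apply: map_f.
have bq : off q'.1 + s' \in block q' by apply: map_f.
have pq : p' = q'.
  case: (ltngtP p'.1 q'.1) => [l|l|]; last exact: Zinj.
    by have := block_cmp pZ qZ l bp bq; rewrite E ltnn.
  by have := block_cmp qZ pZ l bq bp; rewrite E ltnn.
by subst q'; move/addnI: E => ->.
Qed.

Lemma perm_inflate : is_perm (flatten (inflate e)).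
Proof.
apply/is_permP; split=> // x /flattenP[_ /mapP[p pZ ->]] xp.
rewrite size_inflate; have := off_total pZ.
by move: xp; rewrite -/(block p) mem_block //; lia.
Qed.

Lemma inflate_blocked : blocked (inflate e).
Proof.
split=> // [_ /mapP[p pZ ->]|_ /mapP[p pZ ->] x y z].
  by have [_] := Z2 pZ; case: (p.2).
rewrite -/(block p) => xp yp /flattenP[_ /mapP[q qZ ->]]; rewrite -/(block q) => zq h.
case: (ltngtP p.1 q.1) => [l|l|/(Zinj pZ qZ) -> //].
  by have := block_cmp pZ qZ l yp zq; lia.
by have := block_cmp qZ pZ l zq xp; lia.
Qed.

Lemma pattern_inflate : pattern (inflate e) = e.
Proof.
rewrite [RHS]surjective_pairing /pattern; congr pair.
  have h p q : p \in Z -> q \in Z -> (head 0 (block p) <= head 0 (block q)) = (p.1 <= q.1).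
    have hd r : r \in Z -> head 0 (block r) \in block r.
      by move=> rZ; apply: (mem_heads inflate_blocked); apply: map_f.
    move=> pZ qZ; have hp := hd p pZ; have hq := hd q qZ.
    case: (ltngtP p.1 q.1) => [l|l|/(Zinj pZ qZ) ->]; last by rewrite leqnn.
      by rewrite ltnW // (block_cmp pZ qZ l).
    by apply/negbTE; rewrite -ltnNge (block_cmp qZ pZ l).
  rewrite -[RHS](std_of_perm); last by case: eP.
  rewrite /inflate /heads -map_comp -/Z -[in RHS]Z_unzip1 !stdE -!map_comp.
  apply/eq_in_map => p pZ /=; rewrite /rank !count_map.
  by apply: eq_in_count => q qZ /=; apply: h.
rewrite /inflate -map_comp -/Z -[in RHS]Z_unzip2.
apply/eq_in_map => p pZ /=; rewrite (@std_mono p.2) => [|x y _ _].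
  by apply: std_of_perm; case: (Z2 pZ).
by rewrite ltn_add2l.
Qed.

End Inflate.

Lemma blocks_pattern_good (bs : seq (seq nat)) : blocked bs -> good_pattern (pattern bs).
Proof.
move=> B; have [u nb _] := B; split=> /=.
- exact/std_perm/heads_uniq.
- by rewrite size_std !size_map.
move=> _ /mapP[b bb ->]; split; last by move/std_nil; apply: nb.
by apply: std_perm; rewrite -(flatten_blockK u bb) filter_uniq.
Qed.

(** Inflation and pattern are mutually inverse between good patterns and lists of
    blocks whose concatenation is a permutation, so if each word of [W] is cut into
    blocks with pattern in [E] in exactly one way, then [W] and [E] are
    equinumerous. *)
Lemma count_blocks (W : pred (seq nat)) (n : nat) (E : seq (seq nat * seq (seq nat))) :
  uniq E ->
  (forall e, e \in E -> good_pattern e /\ sumn [seq size t | t <- e.2] = n) ->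
  (forall w, is_perm w -> size w = n -> W w ->
     exists bs, [/\ blocked bs, flatten bs = w & pattern bs \in E]) ->
  (forall bs, is_perm (flatten bs) -> size (flatten bs) = n -> blocked bs ->
     pattern bs \in E -> W (flatten bs)) ->
  (forall bs cs, blocked bs -> blocked cs -> pattern bs \in E -> pattern cs \in E ->
     flatten bs = flatten cs -> bs = cs) ->
  count W (permutations (iota 1 n)) = size E.
Proof.
move=> uE gE ex ok un; rewrite -size_filter -(size_map (flatten \o inflate) E).
apply: perm_size; apply: uniq_perm.
- exact/filter_uniq/permutations_uniq.
- rewrite map_inj_in_uniq // => e f eE fE /= h.
  have [ge _] := gE e eE; have [gf _] := gE f fE.
  rewrite -(pattern_inflate ge) -(pattern_inflate gf); congr pattern.
  by apply: un; rewrite ?pattern_inflate //; apply: inflate_blocked.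
move=> w; rewrite mem_filter mem_permutations; apply/andP/mapP => [[Ww pw]|[e eE ->]].
  have sw : size w = n by rewrite (perm_size pw) size_iota.
  have ip : is_perm w by rewrite /is_perm sw.
  have [bs [B ew pE]] := ex w ip sw Ww.
  by exists (pattern bs); rewrite //= inflate_pattern ?ew.
have [ge se] := gE e eE; have pw := perm_inflate ge.
have sz : size (flatten (inflate e)) = n by rewrite size_inflate.
split; last by move: pw; rewrite /is_perm sz.
by apply: ok; rewrite ?pattern_inflate //; apply: inflate_blocked.
Qed.

(** * Generating functions of sums and of simple inflations *)

Definition perms_in (c : pred (seq nat)) (n : nat) : seq (seq nat) :=
  [seq w <- permutations (iota 1 n) | c w].

Lemma is_perm_size (w : seq nat) (n : nat) :
  perm_eq w (iota 1 n) = is_perm w && (size w == n).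
Proof.
apply/idP/andP => [h|[h /eqP <-] //].
by have e : size w = n by [rewrite (perm_size h) size_iota]; rewrite /is_perm e h eqxx.
Qed.

Lemma mem_perms_in (c : pred (seq nat)) (n : nat) (w : seq nat) :
  (w \in perms_in c n) = [&& c w, is_perm w & size w == n].
Proof. by rewrite mem_filter mem_permutations is_perm_size. Qed.

Definition perms_upto (c : pred (seq nat)) (n : nat) : seq (seq nat) :=
  [seq w | i <- iota 0 n.+1, w <- perms_in c i].

Lemma mem_perms_upto (c : pred (seq nat)) (n : nat) (w : seq nat) :
  (w \in perms_upto c n) = [&& c w, is_perm w & size w <= n].
Proof.
apply/allpairsPdep/and3P => [[i [t [ii + ->]]]|[cw pw sw]].
  by rewrite mem_perms_in => /and3P[-> -> /eqP ->]; move: ii; rewrite mem_iota.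
exists (size w), w; split=> //; first by rewrite mem_iota.
by rewrite mem_perms_in cw pw eqxx.
Qed.

Lemma uniq_perms_upto (c : pred (seq nat)) (n : nat) : uniq (perms_upto c n).
Proof.
apply: allpairs_uniq_dep => [|i _|]; first exact: iota_uniq.
  exact/filter_uniq/permutations_uniq.
move=> [i t] [j s] /allpairsPdep[i' [t' [_ + [-> ->]]]] /allpairsPdep[j' [s' [_ + [-> ->]]]] /= E.
by rewrite E !mem_perms_in => /and3P[_ _ /eqP <-] /and3P[_ _ /eqP <-].
Qed.

(** The lists of permutations of total size [n] whose k-th member belongs to the
    k-th class. *)
Fixpoint word_lists (cs : seq (pred (seq nat))) (n : nat) : seq (seq (seq nat)) :=
  if cs is c :: cs' then
    [seq t :: l | t <- perms_upto c n, l <- word_lists cs' (n - size t)]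
  else if n is 0 then [:: [::]] else [::].

Lemma mem_word_lists (cs : seq (pred (seq nat))) (n : nat) (l : seq (seq nat)) :
  (l \in word_lists cs n) =
  all2 (fun c t => c t && is_perm t) cs l && (sumn [seq size t | t <- l] == n).
Proof.
elim: cs n l => [|c cs IH] n l.
  by case: n l => [|n] [|t l].
apply/allpairsPdep/idP => [[t [l' [+ + ->]]]|].
  rewrite mem_perms_upto IH => /and3P[ct pt st] /andP[al /eqP e] /=.
  by rewrite ct pt al e subnKC // eqxx.
case: l => [|t l] //= /andP[/andP[/andP[ct pt] al] /eqP e].
exists t, l; split=> //; first by rewrite mem_perms_upto ct pt -e leq_addr.
by rewrite IH al -e addKn eqxx.
Qed.

Lemma uniq_word_lists (cs : seq (pred (seq nat))) (n : nat) : uniq (word_lists cs n).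
Proof.
elim: cs n => [|c cs IH] n; first by case: n.
apply: allpairs_uniq_dep => //; first exact: uniq_perms_upto.
by move=> [t l] [s k] _ _ /= [-> ->].
Qed.

Local Open Scope ring_scope.

Definition gf (c : pred (seq nat)) : fps int :=
  FPS (fun n => (count c (permutations (iota 1 n)))%:Z).

Lemma eq_gf (c c' : pred (seq nat)) :
  (forall w, is_perm w -> c w = c' w) -> gf c = gf c'.
Proof.
move=> h; apply: fpsP => n /=; congr Posz; apply: eq_in_count => w.
by rewrite mem_permutations is_perm_size => /andP[/h].
Qed.

Lemma sum_perms_upto (c : pred (seq nat)) (n : nat) (f : nat -> int) :
  \sum_(t <- perms_upto c n) f (size t) = \sum_(i < n.+1) fcoef (gf c) i * f i.
Proof.
rewrite -(big_mkord xpredT (fun i => fcoef (gf c) i * f i)) /index_iota subn0.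
rewrite /perms_upto big_allpairs_dep.
apply: eq_bigr => i _; rewrite /= -size_filter -/(perms_in c i).
rewrite (eq_big_seq (fun=> f i)) => [|t]; last by rewrite mem_perms_in => /and3P[_ _ /eqP ->].
by rewrite big_const_seq count_predT iter_addr addr0 -mulr_natl natz.
Qed.

Lemma size_word_lists (cs : seq (pred (seq nat))) (n : nat) :
  (size (word_lists cs n))%:Z = fcoef (\prod_(c <- cs) gf c) n.
Proof.
elim: cs n => [|c cs IH] n; first by rewrite big_nil; case: n.
rewrite big_cons [word_lists _ _]/= size_allpairs_dep sumnE big_map -natz natr_sum.
rewrite (eq_bigr (fun t => fcoef (\prod_(c <- cs) gf c) (n - size t)%N)); last first.
  by move=> t _; rewrite natz IH.
exact: (sum_perms_upto c n (fun k => fcoef (\prod_(c <- cs) gf c) (n - k)%N)).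
Qed.

Arguments word_lists : simpl never.

Local Close Scope ring_scope.

(** A cut witnessing decomposability; as in [decomposable], [d] tells sums from skew
    sums. *)
Definition ordered_cut (d : bool) (u v : seq nat) : Prop :=
  [/\ u <> [::], v <> [::]
    & forall x y, x \in u -> y \in v -> if d then x < y else y < x].

Lemma ordered_cut_dec (d : bool) (u v : seq nat) :
  ordered_cut d u v -> decomposable d (u ++ v).
Proof. by case=> nu nv h; exists u, v. Qed.

(** Cutting again the left part as long as possible. *)
Lemma minimal_cut (d : bool) (w : seq nat) : decomposable d w ->
  exists u v, [/\ w = u ++ v, ordered_cut d u v & ~ decomposable d u].
Proof.
case=> u; have [n] := ubnP (size u); elim: n u => // n IH u un [v [e nu nv h]].
have [[u1 [u2 [e1 n1 n2 h1]]]|nd] := pselect (decomposable d u); last by exists u, v.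
apply: (IH u1).
  move: un; rewrite e1 size_cat; case: (u2) n2 => //= a s _; lia.
exists (u2 ++ v); split=> //.
- by rewrite catA -e1.
- by case: (u2) n2.
move=> x y xu; rewrite mem_cat => /orP[yu|yv]; first exact: h1.
by apply: h => //; rewrite e1 mem_cat xu.
Qed.

(** A cut inside [u'] would decompose [u']. *)
Lemma cut_prefix (d : bool) (u v u' v' : seq nat) :
  u ++ v = u' ++ v' -> ordered_cut d u v -> ordered_cut d u' v' ->
  ~ decomposable d u' -> size u' <= size u.
Proof.
move=> e [nu nv h] [nu' nv' h'] nd; rewrite leqNgt; apply/negP => lt; apply: nd.
have eu : u' = u ++ drop (size u) u'.
  have := congr1 (take (size u)) e; rewrite take_size_cat // take_cat lt => eu.
  by rewrite -[LHS](cat_take_drop (size u)) -eu.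
exists u, (drop (size u) u'); split=> //.
  by move/(congr1 size); rewrite size_drop /=; lia.
move=> x y xu yd; apply: h => //.
have : u ++ v = u ++ (drop (size u) u' ++ v') by rewrite catA -eu.
by move/eqP; rewrite eqseq_cat // eqxx => /eqP ->; rewrite mem_cat yd.
Qed.

Lemma cut_unique (d : bool) (u v u' v' : seq nat) :
  u ++ v = u' ++ v' -> ordered_cut d u v -> ordered_cut d u' v' ->
  ~ decomposable d u -> ~ decomposable d u' -> u = u' /\ v = v'.
Proof.
move=> e c c' nd nd'.
have s : size u = size u'.
  by apply/eqP; rewrite eqn_leq (cut_prefix (esym e) c' c nd) (cut_prefix e c c' nd').
by move/eqP: e; rewrite eqseq_cat // => /andP[/eqP -> /eqP ->].
Qed.

Definition quotient2 (d : bool) : seq nat := if d then [:: 1; 2] else [:: 2; 1].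

Lemma std2 (d : bool) (x y : nat) : (if d then x < y else y < x) ->
  std [:: x; y] = quotient2 d.
Proof. by case: d => h; rewrite /std /= !leqnn (ltnW h) leqNgt h. Qed.

Lemma cut_blocked (d : bool) (u v : seq nat) : uniq (u ++ v) ->
  ordered_cut d u v -> blocked [:: u; v].
Proof.
move=> un [nu nv h]; split; rewrite /= ?cats0 //.
  by move=> b; rewrite !inE => /orP[/eqP ->|/eqP ->].
move=> b; rewrite !inE => /orP[/eqP ->|/eqP ->] x y z xb yb; rewrite mem_cat.
  by case/orP=> // zv; have := h x z xb zv; have := h y z yb zv; case: (d); lia.
by case/orP=> // zu; have := h z x zu xb; have := h z y zu yb; case: (d); lia.
Qed.

Lemma mem_head0 (u : seq nat) : u <> [::] -> head 0 u \in u.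
Proof. by case: u => // a u _; rewrite mem_head. Qed.

Lemma cut_pattern (d : bool) (u v : seq nat) : ordered_cut d u v ->
  pattern [:: u; v] = (quotient2 d, [:: std u; std v]).
Proof.
by case=> nu nv h; congr pair; apply: std2; apply: h; apply: mem_head0.
Qed.

Lemma pattern_cut (d : bool) (bs : seq (seq nat)) (t : seq (seq nat)) :
  blocked bs -> pattern bs = (quotient2 d, t) ->
  exists u v, [/\ bs = [:: u; v], t = [:: std u; std v] & ordered_cut d u v].
Proof.
move=> B []; case: bs B => [|u [|v [|? ?]]] B; try by case: (d).
move=> e <-; exists u, v; split=> //; have [un nb _] := B.
have nu : u <> [::] by apply: nb; rewrite mem_head.
have vb : v \in [:: u; v] by rewrite !inE eqxx orbT.
have nv : v <> [::] by apply: nb.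
have hu := mem_head0 nu; have hv := mem_head0 nv.
have nuv : u <> v.
  move=> E; move: un; rewrite /= cats0 -E cat_uniq => /and3P[_ /hasPn /(_ _ hu)].
  by rewrite /= hu.
split=> // x y xu yv.
have : if d then head 0 u < head 0 v else head 0 v < head 0 u.
  move: e; rewrite /std /= !leqnn; case: (d) => /=; case: leqP; case: leqP => //=; lia.
case: (d) => h.
  by rewrite -(block_lt B (mem_head _ _) vb nuv hu xu hv yv).
by rewrite -(block_lt B vb (mem_head _ _) (nesym nuv) hv yv hu xu).
Qed.

Lemma cat_perm_uniq (w u v : seq nat) : is_perm w -> w = u ++ v ->
  [/\ uniq (u ++ v), uniq u & uniq v].
Proof.
move=> /is_permP[un _] e; move: un; rewrite e => un; split=> //.
  by move: un; rewrite cat_uniq => /and3P[].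
by move: un; rewrite cat_uniq => /and3P[].
Qed.

(** The left part of the cut being indecomposable, the cut is unique, hence a word of
    [W] amounts to a pair of permutations, one in [Q] and one in [R]. *)
Lemma gf_cut (d : bool) (W Q R : pred (seq nat)) :
  Q [::] = false -> R [::] = false ->
  (forall w, is_perm w -> Q w -> ~ decomposable d w) ->
  (forall w, is_perm w -> W w ->
    exists u v, [/\ w = u ++ v, ordered_cut d u v, Q (std u) & R (std v)]) ->
  (forall u v, is_perm (u ++ v) -> ordered_cut d u v -> Q (std u) -> R (std v) ->
    W (u ++ v)) ->
  gf W = (gf Q * gf R)%R.
Proof.
move=> Q0 R0 Qd ex ok; apply: fpsP => n.
have -> : (gf Q * gf R = \prod_(c <- [:: Q; R]) gf c)%R.
  by rewrite !big_cons big_nil mulr1.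
rewrite -size_word_lists -(size_map (pair (quotient2 d))) [LHS]/=; congr Posz.
have memE s t : ((s, t) \in [seq (quotient2 d, l) | l <- word_lists [:: Q; R] n]) ->
    exists a b, [/\ s = quotient2 d, t = [:: a; b], Q a, R b & is_perm a /\ is_perm b /\ size a + size b = n].
  case/mapP=> l + [-> ->]; rewrite mem_word_lists => /andP[].
  case: l => [|a [|b [|? ?]]] //=; rewrite ?andbF ?andbT //.
  move=> /andP[/andP[qa pa] /andP[rb pb]]; rewrite addn0 => /eqP sn.
  by exists a, b.
apply: count_blocks.
- by rewrite map_inj_uniq ?uniq_word_lists // => x y [].
- move=> [s t] /memE[a [b [-> -> qa rb [pa [pb sn]]]]] /=; split; last by rewrite addn0.
  split; [by case: (d) | by case: (d) | rewrite /=].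
  by move=> t'; rewrite !inE => /orP[/eqP ->|/eqP ->]; split=> // E;
    [move: qa; rewrite E Q0 | move: rb; rewrite E R0].
- move=> w pw sw /(ex w pw)[u [v [e c qu rv]]].
  have [un uu uv] := cat_perm_uniq pw e.
  exists [:: u; v]; split; rewrite ?(cut_pattern c) /= ?cats0 //.
    exact: cut_blocked c.
  apply: map_f; rewrite mem_word_lists /= qu rv !std_perm //= !size_std addn0.
  by rewrite -size_cat -e sw.
- move=> bs pw sn B; case E: (pattern bs) => [s t] /memE[a [b [es et qa rb _]]].
  move: E; rewrite es => /(pattern_cut B)[u [v [ebs + c]]]; rewrite et => -[ea eb].
  move: pw; rewrite ebs /= cats0 => pw; apply: ok => //; by rewrite -?ea -?eb.
move=> bs cs B C; case EB: (pattern bs) => [s t]; case EC: (pattern cs) => [s' t'].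
case/memE=> [a [b [es et qa _ [pa _]]]] /memE[a' [b' [es' et' qa' _ [pa' _]]]].
move: EB; rewrite es => /(pattern_cut B)[u [v [ebs + c]]]; rewrite et => -[ea _].
move: EC; rewrite es' => /(pattern_cut C)[u' [v' [ecs + c']]]; rewrite et' => -[ea' _].
rewrite ebs ecs /= !cats0 => e.
have nd x : Q (std x) -> uniq x -> ~ decomposable d x.
  move=> qx ux /(decomposable_mono (@rank_mono x)); apply: Qd => //.
  exact: std_perm.
have [un _ _] := B; have [un' _ _] := C.
move: un un'; rewrite ebs ecs /= !cats0 !cat_uniq => /and3P[uu _ _] /and3P[uu' _ _].
have [] := cut_unique e c c'; last by move=> -> ->.
  by apply: nd => //; rewrite -ea.
by apply: nd => //; rewrite -ea'.
Qed.

(** Each part of a cut is a proper interval, hence lies in one block; this leaves at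
    most two blocks. *)
Lemma simple_not_decomposable (bs : seq (seq nat)) (d : bool) :
  blocked bs -> simple_word (heads bs) -> 2 < size bs ->
  ~ decomposable d (flatten bs).
Proof.
move=> B sb sz [u [v [e nu nv h]]]; have [un nb _] := B.
have Cv : blocked [:: u; v] by apply: (@cut_blocked d); rewrite -?e.
have [_ _ cv] := Cv; rewrite /= cats0 -e in cv.
have [pu pv] : 0 < size u /\ 0 < size v by split; [case: (u) nu | case: (v) nv].
have [b bb sub] : exists2 b, b \in bs & {subset u <= b}.
  apply: (@simple_factor bs [::] u v) => //; first by apply: cv; rewrite mem_head.
  by rewrite e size_cat; lia.
have [c cb svc] : exists2 c, c \in bs & {subset v <= c}.
  apply: (@simple_factor bs u v [::]) => //; rewrite ?cats0 //.
    by apply: cv; rewrite !inE eqxx orbT.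
  by rewrite e size_cat; lia.
have : {subset bs <= [:: b; c]}.
  move=> a ab; have := block_sub ab (mem_heads B ab).
  rewrite e mem_cat !inE => /orP[/sub h'|/svc h'].
    by rewrite (flatten_block_eq un ab bb (mem_heads B ab) h') eqxx.
  by rewrite (flatten_block_eq un ab cb (mem_heads B ab) h') eqxx orbT.
by move/(uniq_leq_size (blocked_uniq B)) => /=; rewrite leqNgt sz.
Qed.

Definition simple_pred (S : pred (seq nat)) : pred (seq nat) :=
  fun s => [&& 2 < size s, `[< simple_word s >] & S s].

(** A word of [W] amounts to a simple permutation in [S], of length [k] say, and [k]
    permutations in [R] whose sizes add up to its length.  The coefficient of a
    substitution counts exactly these. *)
Lemma gf_simple (W S R : pred (seq nat)) :
  R [::] = false ->
  (forall w, is_perm w -> W w -> exists bs,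
    [/\ blocked bs, flatten bs = w, simple_pred S (std (heads bs))
      & forall b, b \in bs -> R (std b)]) ->
  (forall bs, is_perm (flatten bs) -> blocked bs -> simple_pred S (std (heads bs)) ->
    (forall b, b \in bs -> R (std b)) -> W (flatten bs)) ->
  gf W = fps_comp (gf (simple_pred S)) (gf R).
Proof.
move=> R0 ex ok; apply: fpsP => n; rewrite [RHS]/=.
have [E [uE memE sE]] : exists E : seq (seq nat * seq (seq nat)),
   [/\ uniq E,
      forall s t, ((s, t) \in E) = [&& simple_pred S s, is_perm s, size s <= n &
        t \in word_lists (nseq (size s) R) n]
    & ((size E)%:Z = \sum_(k < n.+1) fcoef (gf (simple_pred S)) k * fcoef (gf R ^+ k) n)%R].
  exists [seq (s, l) | s <- perms_upto (simple_pred S) n, l <- word_lists (nseq (size s) R) n].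
  split.
  - apply: allpairs_uniq_dep => [|s _|]; [exact: uniq_perms_upto | exact: uniq_word_lists|].
    by move=> [s l] [s' l'] _ _ /= [-> ->].
  - move=> s t; apply/allpairsPdep/and4P => [[s' [t' [+ + [-> ->]]]]|[ss ps sn tl]].
      by rewrite mem_perms_upto => /and3P[-> -> ->].
    by exists s, t; split=> //; rewrite mem_perms_upto ss ps sn.
  rewrite size_allpairs_dep sumnE big_map -natz natr_sum.
  rewrite (eq_bigr (fun s => fcoef (gf R ^+ size s)%R n)) => [|s _].
    exact: (sum_perms_upto _ _ (fun k => fcoef (gf R ^+ k)%R n)).
  by rewrite natz size_word_lists big_nseq -Monoid.iteropE.
rewrite -sE; congr Posz.
have Rl k (l : seq (seq nat)) : l \in word_lists (nseq k R) n ->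
   [/\ size l = k, forall b, b \in l -> R b /\ is_perm b & sumn [seq size t | t <- l] = n].
  rewrite mem_word_lists => /andP[+ /eqP ->]; elim: l k => [|b l IH] [|k] //=.
  case/andP=> /andP[rb pb] /IH[-> h _]; split=> // c.
  by rewrite inE => /orP[/eqP -> //|/h].
have lR (l : seq (seq nat)) : (forall b, b \in l -> R b /\ is_perm b) ->
    l \in word_lists (nseq (size l) R) (sumn [seq size t | t <- l]).
  move=> h; rewrite mem_word_lists eqxx andbT; elim: l h => //= b l IH h.
  have [-> ->] := h b (mem_head _ _); apply: IH => c cl.
  by apply: h; rewrite inE cl orbT.
apply: count_blocks => //.
- move=> [s l]; rewrite memE => /and4P[/and3P[_ _ _] ps sn /Rl[sl hl tl]].
  split=> //; split=> //= t tl'; have [rt pt] := hl t tl'; split=> // E0.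
  by move: rt; rewrite E0 R0.
- move=> w pw sw Ww; have [bs [B e ss hR]] := ex w pw Ww.
  exists bs; split=> //; have [un nb _] := B; have [/=] := blocks_pattern_good B.
  move=> ph sh hp; rewrite memE ss ph /= !size_std.
  have sl : sumn [seq size t | t <- [seq std b | b <- bs]] = n.
    rewrite -map_comp -sw -e size_flatten /shape; congr sumn.
    by apply: eq_map => b /=; rewrite size_std.
  apply/andP; split.
    rewrite size_map -sw -e -(size_map (head 0)).
    exact: size_subseq (heads_subseq nb).
  rewrite -sl size_map -(size_map std); apply: lR => _ /mapP[b bb ->].
  by split; [exact: hR | case: (hp (std b) (map_f _ bb))].
- move=> bs pw sw B; rewrite memE => /and4P[ss _ _ /Rl[_ hl _]].
  by apply: ok => // b bb; case: (hl (std b) (map_f _ bb)).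
move=> bs cs B C; rewrite !memE => /and4P[/and3P[sb /asboolP simb _] _ _ _].
move=> /and4P[/and3P[sc /asboolP simc _] _ _ _] e.
apply: simple_blocks_unique => //.
- exact/(simple_mono (@rank_mono (heads bs))).
- exact/(simple_mono (@rank_mono (heads cs))).
- by move: sb; rewrite /= size_std size_map.
by move: sc; rewrite /= size_std size_map.
Qed.

(** * Fractal permutations and patterns *)

(** Three entries forming 321 in three distinct blocks give a 321 in the quotient. *)
Lemma avoids_heads (cs : seq (seq nat)) (x y z : nat) :
  blocked cs -> avoids321 (heads cs) ->
  x \in flatten cs -> y \in flatten cs -> z \in flatten cs ->
  index x (flatten cs) < index y (flatten cs) ->
  index y (flatten cs) < index z (flatten cs) -> y < x -> z < y ->
  exists2 c, c \in cs & [\/ x \in c /\ y \in c, y \in c /\ z \in c | x \in c /\ z \in c].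
Proof.
move=> B a /flattenP[b bb xb] /flattenP[c cb yc] /flattenP[d db zd] l1 l2 yx zy.
have [u _ _] := B.
have [E|/eqP nbc] := eqVneq b c; first by exists b => //; constructor 1; rewrite {2}E.
have [E|/eqP ncd] := eqVneq c d; first by exists c => //; constructor 2; rewrite {2}E.
have [E|/eqP nbd] := eqVneq b d; first by exists b => //; constructor 3; rewrite {2}E.
case: (proj1 (avoidsP (heads_uniq B)) a (head 0 b) (head 0 c) (head 0 d));
  rewrite ?map_f //.
- by rewrite heads_index // -(index_flatten_lt u bb cb xb yc).
- by rewrite heads_index // -(index_flatten_lt u cb db yc zd).
- by rewrite (block_lt B cb bb (nesym nbc) (mem_heads B cb) yc (mem_heads B bb) xb).
by rewrite (block_lt B db cb (nesym ncd) (mem_heads B db) zd (mem_heads B cb) yc).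
Qed.

(** A subword with at most one entry in each block is order-isomorphic to a pattern of
    the quotient. *)
Lemma avoids_transversal (cs : seq (seq nat)) (t : seq nat) :
  blocked cs -> avoids321 (heads cs) -> subseq t (flatten cs) ->
  (forall c x y, c \in cs -> x \in t -> y \in t -> x \in c -> y \in c -> x = y) ->
  avoids321 t.
Proof.
move=> B a s h; have [u _ _] := B.
apply/avoidsP => [|x y z xt yt zt]; first exact: subseq_uniq s u.
rewrite !(subseq_index u s) // => l1 l2 yx zy.
have m := mem_subseq s.
have [c cb [[xc yc]|[yc zc]|[xc zc]]] := avoids_heads B a (m _ xt) (m _ yt) (m _ zt) l1 l2 yx zy.
- by move: yx; rewrite (h c x y) // ltnn.
- by move: zy; rewrite (h c y z) // ltnn.
by move: zy yx; rewrite (h c x z) // => /ltnW; rewrite leqNgt => /negbTE ->.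
Qed.

Lemma avoids_std (w : seq nat) : uniq w -> avoids321 (std w) <-> avoids321 w.
Proof. by move=> u; apply: avoids_mono => //; exact: rank_mono. Qed.

Lemma avoids_short (w : seq nat) : size w < 3 -> avoids321 w.
Proof. by move=> h i j k; lia. Qed.

Lemma fractal_perm (w : seq nat) : fractal321 w -> is_perm w /\ w <> [::].
Proof.
case=> [v nv pv _|bs nb pw hb _ _ _] //; split=> //.
case: bs nb hb {pw} => // b bs _ /(_ b (mem_head _ _)); case: b => //.
Qed.

Lemma fractal_blocked (bs : seq (seq nat)) : bs <> [::] -> blocked bs ->
  is_perm (flatten bs) -> (forall b, b \in bs -> fractal321 (std b)) ->
  avoids321 (heads bs) -> fractal321 (flatten bs).
Proof.
move=> nbs B pw fb a; have [u nb cb] := B; apply: fractal_blocks => //.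
  move=> b bb; apply/(interval_convex pw); last exact: cb.
  by move=> x; apply: block_sub.
by apply/avoids_std => //; exact: heads_uniq.
Qed.

(** The induction principle of the fractal class, with its clauses in terms of
    blocked lists. *)
Lemma fractal_blocked_ind (P : seq nat -> Prop) :
  (forall w, w <> [::] -> is_perm w -> avoids321 w -> P w) ->
  (forall bs, bs <> [::] -> blocked bs -> is_perm (flatten bs) ->
     (forall b, b \in bs -> fractal321 (std b)) ->
     (forall b, b \in bs -> P (std b)) ->
     avoids321 (heads bs) -> P (flatten bs)) ->
  forall w, fractal321 w -> P w.
Proof.
move=> h1 h2 w; elim=> [|bs nbs pw nb ib fb IH a]; first exact: h1.
have B : blocked bs.
  split=> // [|b bb]; first by case/is_permP: pw.
  by apply/(interval_convex pw); [move=> x; apply: block_sub | apply: ib].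
by apply: h2 => //; apply/(avoids_std (heads_uniq B)).
Qed.

Lemma filter_neq0_flatten (bs : seq (seq nat)) :
  flatten [seq b <- bs | b != [::]] = flatten bs.
Proof. by elim: bs => //= -[|x b] bs IH //=; rewrite IH. Qed.

Lemma heads_map (f : nat -> nat) (bs : seq (seq nat)) :
  (forall b, b \in bs -> b <> [::]) ->
  heads [seq [seq f x | x <- b] | b <- bs] = [seq f x | x <- heads bs].
Proof.
move=> nb; rewrite /heads -!map_comp; apply/eq_in_map => b /nb /=.
by case: b.
Qed.

Lemma blocked_mono (bs : seq (seq nat)) (f : nat -> nat) :
  mono_on (flatten bs) f -> blocked bs -> blocked [seq [seq f x | x <- b] | b <- bs].
Proof.
move=> fP [u nb cb]; split; rewrite -?map_flatten ?uniq_mono //.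
  by move=> _ /mapP[b /nb nb' ->]; case: b nb'.
move=> _ /mapP[b bb ->]; apply/(convex_mono fP); last exact: cb.
by move=> x; apply: block_sub.
Qed.

Lemma subseq_block (bs : seq (seq nat)) (b : seq nat) : b \in bs -> subseq b (flatten bs).
Proof.
elim: bs => //= a bs IH; rewrite inE => /orP[/eqP ->|/IH h]; first exact: prefix_subseq.
exact: subseq_trans h (suffix_subseq _ _).
Qed.

(** By induction: the traces on [v] of the blocks of [w] cut [v] into blocks, each a
    pattern of a block of [w], and the heads of the traces are a transversal of the
    blocks of [w]. *)
Lemma fractal_pattern (w : seq nat) : fractal321 w ->
  forall v, subseq v w -> v <> [::] -> fractal321 (std v).
Proof.
move: w; apply: fractal_blocked_ind => [w nw pw a v s nv|cs ncs C pw fc IH a v s nv].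
  have [u _] := proj1 (is_permP w) pw; have uv := subseq_uniq s u.
  apply: fractal_avoids; first by move/std_nil.
    exact: std_perm.
  by apply/avoids_std => //; apply: avoids_subseq s a.
have [u nc cc] := C; have uv := subseq_uniq s u.
(* The traces on v of the blocks, without the empty ones. *)
pose vs := [seq b <- [seq [seq x <- c | x \in v] | c <- cs] | b != [::]].
have ev : flatten vs = v.
  by rewrite /vs filter_neq0_flatten -filter_flatten; apply/esym/subseq_uniqP.
have vsP b : b \in vs -> b <> [::] /\ exists2 c, c \in cs & b = [seq x <- c | x \in v].
  by rewrite mem_filter => /andP[/eqP nb /mapP[c cb E]]; split=> //; exists c.
have V : blocked vs.
  split; rewrite ?ev //; first by move=> b /vsP[].
  move=> b /vsP[_ [c cb ->]] x y z.
  rewrite !mem_filter => /andP[xv xc] /andP[yv yc] zv h; rewrite zv.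
  by apply: (cc c cb x y) => //; apply: (mem_subseq s).
have fP : mono_on (flatten vs) (rank v) by rewrite ev; exact: rank_mono.
have -> : std v = flatten [seq [seq rank v x | x <- b] | b <- vs].
  by rewrite -map_flatten ev.
have nvs : vs <> [::] by move=> E; apply: nv; rewrite -ev E.
apply: fractal_blocked; first by case: (vs) nvs.
- exact: blocked_mono.
- by rewrite -map_flatten ev -stdE; exact: std_perm.
- move=> _ /mapP[b bb ->]; have [nb [c cb eb]] := vsP b bb.
  rewrite std_mono; last exact: (mono_sub fP (@block_sub _ _ bb)).
  have sb : subseq b c by rewrite eb; exact: filter_subseq.
  rewrite -(@std_mono b (rank c)); last first.
    exact: (mono_sub (@rank_mono c) (@mem_subseq _ _ _ sb)).
  apply: (IH c cb); first by rewrite stdE; exact: map_subseq.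
  by case: (b) nb.
have nb b : b \in vs -> b <> [::] by case/vsP.
rewrite heads_map //.
have sh : subseq (heads vs) v by rewrite -ev; exact: heads_subseq.
apply/avoids_mono; first exact: heads_uniq V.
  exact: (mono_sub (@rank_mono v) (@mem_subseq _ _ _ sh)).
apply: (avoids_transversal C a); first exact: subseq_trans sh s.
move=> c x y cb /mem_headsP[b bb ->] /mem_headsP[d db ->] xc yc.
have [_ [c1 c1b e1]] := vsP b bb; have [_ [c2 c2b e2]] := vsP d db.
have h1 : head 0 b \in c1 by have := mem_heads V bb; rewrite {2}e1 mem_filter => /andP[].
have h2 : head 0 d \in c2 by have := mem_heads V db; rewrite {2}e2 mem_filter => /andP[].
have E1 := flatten_block_eq u c1b cb h1 xc.
have E2 := flatten_block_eq u c2b cb h2 yc.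
by rewrite e1 e2 E1 E2.
Qed.

Lemma fractal_cut (d : bool) (u v : seq nat) : is_perm (u ++ v) ->
  ordered_cut d u v ->
  fractal321 (u ++ v) <-> fractal321 (std u) /\ fractal321 (std v).
Proof.
move=> pw c; have [un _] := proj1 (is_permP _) pw; have [nu nv _] := c.
split=> [f|[fu fv]].
  by split; apply: (fractal_pattern f) => //; rewrite (prefix_subseq, suffix_subseq).
have B := cut_blocked un c.
have -> : u ++ v = flatten [:: u; v] by rewrite /= cats0.
apply: fractal_blocked => //; first by rewrite /= cats0.
  by move=> b; rewrite !inE => /orP[/eqP ->|/eqP ->].
exact: avoids_short.
Qed.

(** If [w] avoids 321, so does its subword of heads.  If [w] is cut into at least two
    blocks [cs] with a 321-avoiding quotient, each of them is a proper interval and so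
    lies in one of the [bs]; then the heads of the [bs] are a transversal of the
    [cs].  A single block is [w] itself, and the induction hypothesis applies. *)
Lemma fractal_simple_heads (w : seq nat) : fractal321 w ->
  forall bs, blocked bs -> flatten bs = w -> simple_word (heads bs) ->
  2 < size bs -> avoids321 (heads bs).
Proof.
move: w; apply: fractal_blocked_ind => [w nw pw a bs B e sb sz|cs ncs C pw fc IH a bs B e sb sz].
  have [u nb _] := B; apply: avoids_subseq (heads_subseq nb) _ => //.
  by rewrite e.
have [u nb _] := B; have [uc nc cc] := C.
have [sc|sc] := ltnP 1 (size cs).
  apply: (avoids_transversal C a); first by rewrite -e; exact: heads_subseq.
  move=> c x y cC /mem_headsP[b bb ->] /mem_headsP[d db ->] hb hd.
  have [p [q E]] := block_factor cC.
  have [f fb sub] : exists2 f, f \in bs & {subset c <= f}.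
    by apply: (@simple_factor bs p c q); rewrite ?e //; [exact: cc | exact: block_proper].
  have -> := flatten_block_eq u bb fb (mem_heads B bb) (sub _ hb).
  by have -> := flatten_block_eq u db fb (mem_heads B db) (sub _ hd).
case: cs ncs sc C pw IH e {fc a uc nc cc} => [|c [|? ?]] //= _ _ _.
rewrite cats0 => pc IH e; apply: (IH c (mem_head _ _)) => //.
by rewrite std_of_perm.
Qed.

(** * The two classes, case by case *)

Definition decomposableb (d : bool) : pred (seq nat) := fun w => `[< decomposable d w >].

(** The first entry is below the last one in a sum, above it in a skew sum. *)
Lemma cut_exclusive (d : bool) (w : seq nat) : decomposable d w -> ~ decomposable (~~ d) w.
Proof.
case=> u [v [e nu nv h]] [u' [v' [e' nu' nv' h']]].
case: u e nu h => // x u e _ h; case: u' e' nu' h' => // x' u' e' _ h'.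
have ex : x = x' by move: e'; rewrite e => -[].
case/lastP: v e nv h => // v y e _ h; case/lastP: v' e' nv' h' => // v' y' e' _ h'.
have ey : y = y'.
  by have := congr1 (last 0) e'; rewrite e !cat_cons /= !last_cat !last_rcons.
have := h x y; have := h' x' y'; rewrite -ex -ey !mem_head !mem_rcons !mem_head.
by move=> /(_ isT isT) + /(_ isT isT); case: (d) => /=; lia.
Qed.

Lemma decomposable_size (d : bool) (w : seq nat) : decomposable d w -> 1 < size w.
Proof.
by case=> u [v [-> nu nv _]]; rewrite size_cat; case: u nu => // x u; case: v nv => //= *; lia.
Qed.

Definition two_way_indecomposable (c : pred (seq nat)) : pred (seq nat) :=
  fun w => [&& c w, ~~ decomposableb true w, ~~ decomposableb false w & 1 < size w].

Lemma gf_split (c p : pred (seq nat)) :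
  gf c = (gf (fun w => c w && p w) + gf (fun w => c w && ~~ p w))%R.
Proof.
apply: fpsP => n /=; rewrite -PoszD; congr Posz.
elim: (permutations _) => //= w s ->.
by case: (c w); case: (p w) => /=; lia.
Qed.

Lemma perm_small (w : seq nat) : is_perm w -> size w <= 1 -> w = [::] \/ w = [:: 1].
Proof.
case: w => [|x [|? ?]] //; first by left.
by move=> /is_permP[_ /(_ x)]; rewrite mem_head => /(_ isT) /= h; right; congr cons; lia.
Qed.

Lemma gf_single : gf (pred1 [:: 1]) = fpsX int.
Proof.
apply: fpsP => n /=; rewrite count_uniq_mem ?permutations_uniq //.
rewrite mem_permutations is_perm_size /= eq_sym.
by case: (n == 1); rewrite natz.
Qed.

(** The four terms are the permutation of length 1, the sums, the skew sums and the
    remaining permutations, which are inflations of simple ones. *)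
Lemma gf_decompose (c : pred (seq nat)) : c [::] = false -> c [:: 1] ->
  gf c = (fpsX int + gf (fun w => c w && decomposableb true w)
          + gf (fun w => c w && decomposableb false w) + gf (two_way_indecomposable c))%R.
Proof.
move=> c0 c1; rewrite -gf_single (gf_split c (decomposableb true)).
rewrite (gf_split (fun w => c w && ~~ decomposableb true w) (decomposableb false)).
rewrite (gf_split (fun w => (c w && ~~ decomposableb true w) && ~~ decomposableb false w) (fun w => 1 < size w)).
have -> : gf (fun w => (c w && ~~ decomposableb true w) && decomposableb false w) = gf (fun w => c w && decomposableb false w).
  apply: eq_gf => w _; rewrite -andbA; congr andb.
  by apply: andb_idl => /asboolP/cut_exclusive h; apply/asboolP.
have -> : gf (fun w => ((c w && ~~ decomposableb true w) && ~~ decomposableb false w) && (1 < size w)) = gf (two_way_indecomposable c).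
  by apply: eq_gf => w _; rewrite /two_way_indecomposable !andbA.
have -> : gf (fun w => ((c w && ~~ decomposableb true w) && ~~ decomposableb false w) && ~~ (1 < size w)) = gf (pred1 [:: 1]).
  apply: eq_gf => w pw; rewrite -leqNgt; case: (leqP (size w) 1) => sw.
    case: (perm_small pw sw) => ->; rewrite /= ?c0 // c1 andbT.
    have nd d : decomposableb d [:: 1] = false by apply/asboolP => /decomposable_size.
    by rewrite !nd.
  by rewrite andbF; apply/esym/eqP => E; move: sw; rewrite E.
by rewrite -!addrA; set a := gf (fun w => _ && decomposableb true w); rewrite [RHS]addrC -!addrA addrC -!addrA.
Qed.

Definition increasing (w : seq nat) : Prop :=
  forall x y, x \in w -> y \in w -> index x w < index y w -> x < y.

Lemma increasing_mono (w : seq nat) (f : nat -> nat) : mono_on w f ->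
  increasing [seq f x | x <- w] <-> increasing w.
Proof.
move=> fP; split=> h.
  move=> x y xw yw; have := h (f x) (f y); rewrite !map_f // !(index_mono fP) // fP //.
  by apply.
move=> _ _ /mapP[x xw ->] /mapP[y yw ->]; rewrite !(index_mono fP) // fP //.
exact: h.
Qed.

Lemma increasing_std (w : seq nat) : increasing (std w) <-> increasing w.
Proof. exact: increasing_mono (@rank_mono w). Qed.

Definition nonempty (w : seq nat) : bool := 0 < size w.

Definition fractal_cls : pred (seq nat) := fun w => `[< fractal321 w >].
Definition avoid_cls : pred (seq nat) := fun w => nonempty w && `[< avoids321 w >].
Definition incr_cls : pred (seq nat) := fun w => nonempty w && `[< increasing w >].
Definition simple_cls : pred (seq nat) := simple_pred (fun s => `[< avoids321 s >]).
Definition indecomposable_in (d : bool) (c : pred (seq nat)) : pred (seq nat) :=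
  fun w => c w && ~~ decomposableb d w.

(** The first component of a sum of members is an indecomposable member, and the rest
    is an arbitrary member. *)
Lemma gf_cut_closed (d : bool) (c : pred (seq nat)) : c [::] = false ->
  (forall u v, is_perm (u ++ v) -> ordered_cut d u v ->
     c (u ++ v) <-> c (std u) /\ c (std v)) ->
  gf (fun w => c w && decomposableb d w) = (gf (indecomposable_in d c) * gf c)%R.
Proof.
move=> c0 h; apply: (@gf_cut d) => //; first by rewrite /indecomposable_in c0.
- by move=> w _ /andP[_ /asboolP].
- move=> w pw /andP[cw /asboolP /minimal_cut[u [v [e o nd]]]].
  exists u, v; rewrite /indecomposable_in; have [cu cv] : c (std u) /\ c (std v).
    by apply/h => //; rewrite -e.
  split=> //; rewrite cu /=; apply/asboolP => /(decomposable_mono (@rank_mono u)).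
  exact: nd.
move=> u v pw o /andP[cu _] cv; apply/andP; split; first by apply/h.
by apply/asboolP/ordered_cut_dec.
Qed.

Lemma fractal_cut_closed (d : bool) :
  gf (fun w => fractal_cls w && decomposableb d w) = (gf (indecomposable_in d fractal_cls) * gf fractal_cls)%R.
Proof.
apply: gf_cut_closed; first by apply/asboolP => /fractal_perm[].
move=> u v pw o; split=> [/asboolP/(fractal_cut pw o)[fu fv]|[/asboolP fu /asboolP fv]].
  by split; apply/asboolP.
by apply/asboolP/(fractal_cut pw o).
Qed.

Lemma in_cat_index (u v : seq nat) (x y : nat) :
  x \in v -> x \notin u -> y \in u ++ v -> index x (u ++ v) < index y (u ++ v) ->
  y \in v.
Proof.
move=> xv xu yw; rewrite !index_cat (negbTE xu); case: ifP => [yu|yu _].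
  by have := index_mem y u; rewrite yu; lia.
by move: yw; rewrite mem_cat yu.
Qed.

Lemma cut_disjoint (d : bool) (u v : seq nat) (x : nat) :
  ordered_cut d u v -> x \in v -> x \notin u.
Proof.
case=> _ _ h xv; apply/negP => xu; have := h x x xu xv.
by case: (d); rewrite ltnn.
Qed.

(** An occurrence of 321 cannot go up from the left part to the right part. *)
Lemma avoids_sum (u v : seq nat) : uniq (u ++ v) -> ordered_cut true u v ->
  avoids321 u -> avoids321 v -> avoids321 (u ++ v).
Proof.
move=> un o; have [nu nv h] := o; have := un; rewrite cat_uniq => /and3P[uu _ uv].
move/(avoidsP uu) => au /(avoidsP uv) av; apply/(avoidsP un) => x y z xw yw zw l1 l2 yx zy.
have dis := cut_disjoint o.
case: (boolP (x \in v)) => xv.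
  have yv := in_cat_index xv (dis _ xv) yw l1.
  have zv := in_cat_index yv (dis _ yv) zw l2.
  apply: (av x y z) => //; move: l1 l2;
    by rewrite !(subseq_index un (suffix_subseq u v)).
have mu t : t \in u ++ v -> t \notin v -> t \in u.
  by rewrite mem_cat => /orP[//|->].
have xu := mu _ xw xv.
have yu : y \in u by apply: mu => //; apply/negP => /(h x y xu) /=; rewrite ltnNge (ltnW yx).
have zu : z \in u by apply: mu => //; apply/negP => /(h y z yu) /=; rewrite ltnNge (ltnW zy).
apply: (au x y z) => //; move: l1 l2;
  by rewrite !(subseq_index un (prefix_subseq u v)).
Qed.

Lemma not_increasing (w : seq nat) : ~ increasing w ->
  exists x y, [/\ x \in w, y \in w, index x w < index y w & y < x].
Proof.
move/existsNP => [x /existsNP[y /not_implyP[xw /not_implyP[yw /not_implyP[l n]]]]].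
exists x, y; split=> //; move/negP: n; rewrite -leqNgt leq_eqVlt => /orP[/eqP E|//].
by move: l; rewrite E ltnn.
Qed.

(** A descent in one part and any entry of the other form 321; conversely two of the
    three entries of a 321 are in the same part, where they form a descent. *)
Lemma avoids_skew (u v : seq nat) : uniq (u ++ v) -> ordered_cut false u v ->
  avoids321 (u ++ v) <-> increasing u /\ increasing v.
Proof.
move=> un o; have [nu nv h] := o; have := un; rewrite cat_uniq => /and3P[uu _ uv].
have dis := cut_disjoint o; rewrite avoidsP //.
have su := prefix_subseq u v; have sv := suffix_subseq u v.
have mu := mem_subseq su; have mv := mem_subseq sv.
have luv x y : x \in u -> y \in v -> index x (u ++ v) < index y (u ++ v).
  move=> xu yv; rewrite !index_cat xu (negbTE (dis _ yv)).
  by have := index_mem x u; rewrite xu; lia.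
split=> [a|[iu iv] x y z xw yw zw l1 l2 yx zy].
  split; apply: contrapT => /not_increasing[x [y [xw yw l yx]]].
    have hv := mem_head0 nv; move: l; rewrite (subseq_index un su) // => l.
    exact: (a x y (head 0 v) (mu _ xw) (mu _ yw) (mv _ hv) l (luv _ _ yw hv) yx (h _ _ yw hv)).
  have hu := mem_head0 nu; move: l; rewrite (subseq_index un sv) // => l.
  exact: (a (head 0 u) x y (mu _ hu) (mv _ xw) (mv _ yw) (luv _ _ hu xw) l (h _ _ hu xw) yx).
have mu' t : t \in u ++ v -> t \notin v -> t \in u.
  by rewrite mem_cat => /orP[//|->].
case: (boolP (y \in v)) => yv.
  have zv := in_cat_index yv (dis _ yv) zw l2.
  by have := iv y z yv zv; rewrite (subseq_index un sv) // l2 ltnNge (ltnW zy) => /(_ isT).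
have yu := mu' _ yw yv.
case: (boolP (x \in v)) => xv.
  by have := in_cat_index xv (dis _ xv) yw l1; rewrite (negbTE yv).
have xu := mu' _ xw xv.
by have := iu x y xu yu; rewrite (subseq_index un su) // l1 ltnNge (ltnW yx) => /(_ isT).
Qed.

Lemma nonempty_std (w : seq nat) : nonempty (std w) = nonempty w.
Proof. by rewrite /nonempty size_std. Qed.

Lemma avoid_sum_gf :
  gf (fun w => avoid_cls w && decomposableb true w) = (gf (indecomposable_in true avoid_cls) * gf avoid_cls)%R.
Proof.
apply: gf_cut_closed => // u v pw o; have [un uu uv] := cat_perm_uniq pw erefl.
have [nu nv h] := o; rewrite /avoid_cls !nonempty_std /nonempty size_cat.
have [-> ->] : 0 < size u /\ 0 < size v by case: (u) nu; case: (v) nv.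
rewrite ltn_addr //=; last by case: (u) nu.
split=> [/asboolP a|[/asboolP/(avoids_std uu) au /asboolP/(avoids_std uv) av]].
  split; apply/asboolP/avoids_std => //; apply: avoids_subseq a => //.
    exact: prefix_subseq.
  exact: suffix_subseq.
exact/asboolP/avoids_sum.
Qed.

Lemma increasing_not_skew (w : seq nat) : uniq w -> increasing w -> ~ decomposable false w.
Proof.
move=> un i [u [v [e nu nv h]]]; have hu := mem_head0 nu; have hv := mem_head0 nv.
have := h _ _ hu hv; apply/negP; rewrite -leqNgt ltnW // i ?e ?mem_cat ?hu ?hv ?orbT //.
have o : ordered_cut false u v by split.
rewrite !index_cat hu (negbTE (cut_disjoint o hv)).
by have := index_mem (head 0 u) u; rewrite hu; lia.
Qed.

Lemma avoid_skew_gf :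
  gf (fun w => avoid_cls w && decomposableb false w) = (gf incr_cls * gf incr_cls)%R.
Proof.
apply: (@gf_cut false) => //.
- move=> w /is_permP[un _] /andP[_ /asboolP i]; exact: increasing_not_skew.
- move=> w pw /andP[/andP[_ /asboolP a] /asboolP[u [v [e nu nv h]]]].
  have [un uu uv] := cat_perm_uniq pw e; have o : ordered_cut false u v by split.
  have [iu iv] : increasing u /\ increasing v by apply/avoids_skew => //; rewrite -e.
  exists u, v; split=> //; rewrite /incr_cls nonempty_std.
    by apply/andP; split; [case: (u) nu | apply/asboolP/increasing_std].
  by apply/andP; split; [case: (v) nv | apply/asboolP/increasing_std].
move=> u v pw o /andP[_ /asboolP/increasing_std iu] /andP[_ /asboolP/increasing_std iv].
have [un uu uv] := cat_perm_uniq pw erefl; have [nu nv h] := o.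
rewrite /avoid_cls /nonempty size_cat ltn_addr /=; last by case: (u) nu.
by apply/andP; split; apply/asboolP; [apply/avoids_skew | apply: ordered_cut_dec].
Qed.

Lemma simple_clsP (bs : seq (seq nat)) : blocked bs ->
  simple_cls (std (heads bs)) <->
  [/\ 2 < size bs, simple_word (heads bs) & avoids321 (heads bs)].
Proof.
move=> B; rewrite /simple_cls /simple_pred size_std size_map.
split=> [/and3P[sz /asboolP/(simple_mono (@rank_mono _)) s /asboolP/(avoids_std (heads_uniq B)) a]|].
  by split.
case=> sz s a; apply/and3P; split=> //; apply/asboolP.
  exact/(simple_mono (@rank_mono _)).
exact/(avoids_std (heads_uniq B)).
Qed.

Lemma two_way_indecomposableP (c : pred (seq nat)) (w : seq nat) :
  two_way_indecomposable c w <-> [/\ c w, forall d, ~ decomposable d w & 1 < size w].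
Proof.
split=> [/and4P[cw /asboolP n1 /asboolP n2 sz]|[cw nd sz]].
  by split=> // -[].
by apply/and4P; split=> //; apply/asboolP; apply: nd.
Qed.

Lemma size_simple_blocks (bs : seq (seq nat)) : blocked bs -> 2 < size bs ->
  1 < size (flatten bs).
Proof.
move=> [_ nb _] sz; apply: leq_trans (ltnW sz) _.
by rewrite -(size_map (head 0)); apply: size_subseq (heads_subseq nb).
Qed.

Lemma fractal_indec_gf :
  gf (two_way_indecomposable fractal_cls) = fps_comp (gf simple_cls) (gf fractal_cls).
Proof.
apply: gf_simple => [|w pw /two_way_indecomposableP[/asboolP f nd sz]|bs pw B /(simple_clsP B)[sz s a] R].
- by apply/asboolP => /fractal_perm[].
- have [un _] := proj1 (is_permP _) pw.
  have [bs [B e sb s]] := simple_blocks_exist un sz nd; exists bs; split=> //.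
    by apply/(simple_clsP B); split=> //; apply: (fractal_simple_heads f).
  move=> b bb; apply/asboolP; have [_ nb _] := B.
  by apply: (fractal_pattern f); [rewrite -e; exact: subseq_block | exact: nb].
apply/two_way_indecomposableP; split.
- apply/asboolP/fractal_blocked => //; first by case: (bs) sz.
  by move=> b /R/asboolP.
- by move=> d; apply: simple_not_decomposable.
exact: size_simple_blocks.
Qed.

(** If a block contains a descent, avoidance forces the entries before the block to lie
    below it and those after it to lie above it, so that the word is a sum. *)
Lemma block_increasing (bs : seq (seq nat)) (b : seq nat) : blocked bs -> 2 < size bs ->
  avoids321 (flatten bs) -> ~ decomposable true (flatten bs) -> b \in bs ->
  increasing b.
Proof.
move=> B sz a nd bb; have [un nb cb] := B; move/(avoidsP un): a => a.
apply: contrapT => /not_increasing[y [z [yb zb l zy]]]; apply: nd.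
have [p [q e]] := block_factor bb; have sb := subseq_block bb.
have wsz := block_proper (ltnW sz) nb bb.
have := un; rewrite e cat_uniq cat_uniq => /and3P[up dp /and3P[ub dq uq]].
move: dp dq => /hasPn dp /hasPn dq.
have npb t : t \in p -> t \notin b.
  by move=> tp; apply/negP => tb; have := dp t; rewrite mem_cat tb /= tp => /(_ isT).
have nqb t : t \in q -> t \notin b by move=> /dq.
have yw := mem_subseq sb yb; have zw := mem_subseq sb zb.
have l' : index y (flatten bs) < index z (flatten bs) by rewrite -(subseq_index un sb).
have cmp t s : t \in flatten bs -> t \notin b -> s \in b -> (t < s) = (t < y) /\ (t < y) = (t < z).
  move=> /flattenP[c cB tc] tb sB; have ncb : c <> b by move=> E; move: tb; rewrite -E tc.
  by rewrite !(block_lt B cB bb ncb tc tc sB yb) (block_lt B cB bb ncb tc tc yb zb).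
have ltp t s : t \in p -> s \in b -> t < s.
  move=> tp sB; have tw : t \in flatten bs by rewrite e mem_cat tp.
  have [-> _] := cmp t s tw (npb t tp) sB.
  rewrite ltnNge; apply/negP; rewrite leq_eqVlt => /orP[/eqP E|yt].
    by have := npb t tp; rewrite -E yb.
  apply: (a t y z) => //; rewrite e !index_cat tp.
  have -> : y \in p = false by apply/negP => /npb; rewrite yb.
  by apply: leq_trans (leq_addr _ _); rewrite index_mem.
have ltq t s : t \in q -> s \in b -> s < t.
  move=> tq sB; have tw : t \in flatten bs by rewrite e !mem_cat tq !orbT.
  have [E1 E2] := cmp t s tw (nqb t tq) sB.
  rewrite ltnNge; apply/negP; rewrite leq_eqVlt => /orP[/eqP E|ts].
    by have := nqb t tq; rewrite E sB.
  apply: (a y z t) => //; last by rewrite -E2 -E1.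
  rewrite e !index_cat zb.
  have -> : z \in p = false by apply/negP => /npb; rewrite zb.
  have -> : t \in p = false by apply/negbTE/dp; rewrite mem_cat tq orbT.
  rewrite (negbTE (nqb t tq)) ltn_add2l.
  by apply: leq_trans (leq_addr _ _); rewrite index_mem.
have hb := mem_head0 (nb b bb).
case: (p =P [::]) => [p0|np].
  exists b, q; split; [by rewrite p0 | exact: nb | | by move=> s t sB tq; apply: ltq].
  by move=> q0; move: wsz; rewrite e p0 q0 cats0 ltnn.
exists p, (b ++ q); split=> //; first by case: (b) (nb b bb).
move=> t s tp; rewrite mem_cat => /orP[|sq]; first exact: ltp.
exact: ltn_trans (ltp _ _ tp hb) (ltq _ _ sq hb).
Qed.

(** Blocks of a 321-avoiding word which is not a sum are increasing; conversely, with
    increasing blocks the entries of a 321 are in distinct blocks. *)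
Lemma avoid_indec_gf :
  gf (two_way_indecomposable avoid_cls) = fps_comp (gf simple_cls) (gf incr_cls).
Proof.
apply: gf_simple => [//|w pw /two_way_indecomposableP[/andP[_ /asboolP a] nd sz]|bs pw B /(simple_clsP B)[sz s a] R].
  have [un _] := proj1 (is_permP _) pw.
  have [bs [B e sb s]] := simple_blocks_exist un sz nd; exists bs; split=> //.
    apply/(simple_clsP B); split=> //; have [ub nb _] := B.
    by apply: avoids_subseq (heads_subseq nb) _ => //; rewrite e.
  move=> b bb; have [_ nb _] := B; rewrite /incr_cls nonempty_std; apply/andP; split.
    by case: (b) (nb b bb).
  by apply/asboolP/increasing_std; apply: (block_increasing B) => //; rewrite e.
have [un nb _] := B; have sz2 := size_simple_blocks B sz.
have inc b : b \in bs -> increasing b by move=> /R/andP[_ /asboolP/increasing_std].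
apply/two_way_indecomposableP; split=> //; last by move=> d; apply: simple_not_decomposable.
apply/andP; split; first exact: ltnW.
apply/asboolP/avoidsP => // x y z xw yw zw l1 l2 yx zy.
have ord c t1 t2 : c \in bs -> t1 \in c -> t2 \in c ->
    index t1 (flatten bs) < index t2 (flatten bs) -> t1 < t2.
  move=> cb tc1 tc2; rewrite -(subseq_index un (subseq_block cb)) //; exact: inc.
have [c cb [[xc yc]|[yc zc]|[xc zc]]] := avoids_heads B a xw yw zw l1 l2 yx zy.
- by have := ord c x y cb xc yc l1; lia.
- by have := ord c y z cb yc zc l2; lia.
by have := ord c x z cb xc zc (ltn_trans l1 l2); lia.
Qed.

Lemma fractal_gfE : fractal_gf = gf fractal_cls.
Proof.
apply: fpsP => -[|n] //=; rewrite /fractal_cls; case: asboolP => // /fractal_perm[].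
by [].
Qed.

Lemma irreducible_gfE : irreducible_gf = gf simple_cls.
Proof.
apply: fpsP => n /=; rewrite /num_irreducible321.
case: ifP => n3; congr Posz.
  apply: eq_in_count => w; rewrite mem_permutations is_perm_size => /andP[pw /eqP sw].
  rewrite /simple_cls /simple_pred sw n3 /= -asbool_and; apply: asbool_equiv_eq.
  by rewrite abs_irreducibleP.
apply/esym/eqP; rewrite eqn0Ngt -has_count; apply/hasPn => w.
rewrite mem_permutations is_perm_size => /andP[pw /eqP sw].
by rewrite /simple_cls /simple_pred sw n3.
Qed.

(** * The Catalan equation for 321-avoiders *)

Lemma increasingP (w : seq nat) : uniq w -> increasing w <-> pairwise ltn w.
Proof.
move=> u; rewrite -(sorted_pairwise ltn_trans); split=> [i|s x y xw yw].
  apply/(sortedP 0) => k kw; apply: i; rewrite ?mem_nth // ?index_uniq //; exact: ltnW.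
exact: (sorted_ltn_index ltn_trans s).
Qed.

(** The maximum can only play the role of 3. *)
Lemma avoids_insert_max (u v : seq nat) (m : nat) : uniq (u ++ m :: v) ->
  (forall x, x \in u ++ v -> x < m) ->
  avoids321 (u ++ m :: v) <-> avoids321 (u ++ v) /\ increasing v.
Proof.
move=> un mx.
have s : subseq (u ++ v) (u ++ m :: v) by rewrite cat_subseq // subseq_cons.
have un' := subseq_uniq s un.
have sv : subseq (m :: v) (u ++ m :: v) by exact: suffix_subseq.
have uv : uniq (m :: v) := subseq_uniq sv un.
have mv : m \notin v by case/andP: uv.
have mm x : x \in u ++ m :: v -> x = m \/ x \in u ++ v.
  by rewrite !mem_cat inE => /or3P[->|/eqP ->|->]; rewrite ?orbT; [right | left | right].
split=> [a|[/(avoidsP un') a i]].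
  split; first exact: avoids_subseq a.
  apply: contrapT => /not_increasing[x [y [xv yv l yx]]].
  have xm : m == x = false by apply/eqP => E; move: mv; rewrite E xv.
  have ym : m == y = false by apply/eqP => E; move: mv; rewrite E yv.
  have [mc xc yc] : [/\ m \in m :: v, x \in m :: v & y \in m :: v].
    by rewrite !inE eqxx xv yv !orbT.
  have ms := mem_subseq sv; have mxx := mx x; rewrite mem_cat xv orbT in mxx.
  apply: (proj1 (avoidsP un) a m x y (ms _ mc) (ms _ xc) (ms _ yc) _ _ (mxx isT) yx);
    by rewrite -(subseq_index un sv) //= ?eqxx ?xm ?ym.
apply/(avoidsP un) => x y z xw yw zw l1 l2 yx zy.
have le t : t \in u ++ m :: v -> t <= m by case/mm => [->//|/mx/ltnW].
have [ym|yuv] := mm y yw; first by have := le x xw; rewrite -ym leqNgt yx.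
have [zm|zuv] := mm z zw; first by have := le y yw; rewrite -zm leqNgt zy.
have [xm|xuv] := mm x xw.
  have mu : m \notin u by move: un; rewrite cat_uniq /= negb_or => /and3P[_ /andP[]].
  have mmv : m \in m :: v by rewrite mem_head.
  have h t : t \in u ++ m :: v -> index m (u ++ m :: v) < index t (u ++ m :: v) -> t \in v.
    move=> tw l; have := in_cat_index mmv mu tw l.
    by rewrite inE => /orP[/eqP E|//]; move: l; rewrite E ltnn.
  rewrite xm in l1; have yv := h y yw l1.
  have zv := h z zw (ltn_trans l1 l2).
  have sv' : subseq v (u ++ m :: v) by apply: subseq_trans sv; exact: subseq_cons.
  have := i y z yv zv; rewrite (subseq_index un sv') // => /(_ l2).
  by rewrite ltnNge (ltnW zy).
by apply: (a x y z) => //; rewrite (subseq_index un s).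
Qed.

(** The 321-avoiding words whose last [i] entries are increasing. *)
Definition tail_increasing (i : nat) : pred (seq nat) := fun w =>
  [&& i <= size w, `[< avoids321 w >] & pairwise ltn (drop (size w - i) w)].

(** The new maximum is inserted before the last [j] entries. *)
Definition insert_max (w : seq nat) (j : nat) : seq nat :=
  take (size w - j) w ++ (size w).+1 :: drop (size w - j) w.

Lemma size_insert_max (w : seq nat) (j : nat) : size (insert_max w j) = (size w).+1.
Proof. by rewrite /insert_max size_cat /= addnS -size_cat cat_take_drop. Qed.

Lemma perm_insert_max (w : seq nat) (j : nat) : is_perm w -> is_perm (insert_max w j).
Proof.
move=> pw; rewrite /is_perm size_insert_max /insert_max.
rewrite -cat1s perm_catCA cat_take_drop -(addn1 (size w)) iotaD add1n addn1.
by rewrite perm_sym perm_catC perm_cat2l perm_sym.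
Qed.

Lemma perm_lt_max (w : seq nat) (x : nat) : is_perm w -> x \in w -> x < (size w).+1.
Proof. by move=> pw; rewrite perm_mem_range // => /andP[]. Qed.

Lemma avoids_insert (w : seq nat) (j : nat) : is_perm w ->
  `[< avoids321 (insert_max w j) >] =
  `[< avoids321 w >] && pairwise ltn (drop (size w - j) w).
Proof.
move=> pw; have [uw _] := proj1 (is_permP w) pw.
have [ui _] := proj1 (is_permP _) (perm_insert_max j pw).
have h : avoids321 (insert_max w j) <-> avoids321 w /\ increasing (drop (size w - j) w).
  rewrite -{2}(cat_take_drop (size w - j) w); apply: avoids_insert_max => // x.
  by rewrite cat_take_drop; exact: perm_lt_max.
apply/asboolP/andP => [/h[a /increasingP i]|[/asboolP a i]].
  by split; [apply/asboolP | apply: i; exact: drop_uniq].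
by apply/h; split=> //; apply/increasingP => //; exact: drop_uniq.
Qed.

Lemma insert_max_last (w : seq nat) : insert_max w 0 = rcons w (size w).+1.
Proof. by rewrite /insert_max subn0 take_size drop_size cats1. Qed.

Lemma tail_insert_last (w : seq nat) (i : nat) : is_perm w ->
  tail_increasing i.+1 (insert_max w 0) = tail_increasing i w.
Proof.
move=> pw; rewrite /tail_increasing avoids_insert // subn0 drop_size andbT size_insert_max ltnS.
congr andb; congr andb; rewrite subSS insert_max_last drop_rcons ?leq_subr //.
rewrite pairwise_rcons andb_idl // => _; apply/allP => x /mem_drop.
exact: perm_lt_max.
Qed.

Lemma tail_insert (w : seq nat) (i j : nat) : is_perm w -> j < size w ->
  tail_increasing i (insert_max w j.+1) = (i <= j.+1) && tail_increasing j.+1 w.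
Proof.
move=> pw jw; rewrite /tail_increasing avoids_insert // jw size_insert_max.
set n := size w; have [le|lt] := leqP i j.+1.
  rewrite (leq_trans le (leqW jw)) /=; apply: andb_idr => /andP[_ p].
  have -> : drop (n.+1 - i) (insert_max w j.+1) = drop (j.+1 - i) (drop (n - j.+1) w).
    rewrite /insert_max -/n drop_cat size_takel ?leq_subr //.
    rewrite ltnNge (_ : n - j.+1 <= n.+1 - i); last by lia.
    rewrite (_ : n.+1 - i - (n - j.+1) = (j.+1 - i).+1) //; move: jw le; rewrite -/n; lia.
  by apply: subseq_pairwise p; exact: drop_subseq.
apply/negbTE; rewrite !negb_and; apply/orP; right; apply/orP; right.
apply/negP => p.
have : pairwise ltn (n.+1 :: drop (n - j.+1) w).
  apply: subseq_pairwise p.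
  rewrite /insert_max -/n drop_cat size_takel ?leq_subr //.
  case: ltnP => h; first exact: suffix_subseq.
  by rewrite (_ : n.+1 - i - (n - j.+1) = 0) //; move: jw lt h; rewrite -/n; lia.
rewrite pairwise_cons => /andP[/allP al _].
have : nth 0 w (n - j.+1) \in drop (n - j.+1) w.
  have := mem_nth 0 (_ : 0 < size (drop (n - j.+1) w)); rewrite nth_drop addn0; apply.
  by rewrite size_drop -/n; move: jw; rewrite -/n; lia.
move=> h; have := al _ h; have := perm_lt_max pw (mem_drop h).
by rewrite -/n /=; lia.
Qed.

Lemma insert_max_inj (w w' : seq nat) (j j' : nat) : is_perm w -> is_perm w' ->
  j <= size w -> j' <= size w' -> size w = size w' ->
  insert_max w j = insert_max w' j' -> w = w' /\ j = j'.
Proof.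
move=> pw pw' jw jw' sz e.
have idx v i : is_perm v -> i <= size v -> index (size v).+1 (insert_max v i) = size v - i.
  move=> pv iv; rewrite /insert_max index_cat /= eqxx addn0 size_takel ?leq_subr //.
  by case: ifP => // /mem_take/(perm_lt_max pv); rewrite ltnn.
have ej : j = j'.
  have := idx w j pw jw; rewrite e sz idx // => h.
  by move: jw jw'; rewrite sz => jw jw'; lia.
split=> //; subst j'; move: e; rewrite /insert_max sz => /eqP.
rewrite eqseq_cat; last by rewrite !size_takel ?sz ?leq_subr.
case/andP => /eqP e1 /eqP[e2].
by rewrite -(cat_take_drop (size w' - j) w) e1 e2 cat_take_drop.
Qed.

Lemma permutations_insert (n : nat) :
  perm_eq (permutations (iota 1 n.+1))
    [seq insert_max w j | w <- permutations (iota 1 n), j <- iota 0 n.+1].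
Proof.
apply: uniq_perm; first exact: permutations_uniq.
  apply: allpairs_uniq; [exact: permutations_uniq | exact: iota_uniq|].
  have mem w j : (w, j) \in [seq (x, y) | x <- permutations (iota 1 n), y <- iota 0 n.+1] ->
      [/\ is_perm w, size w = n & j <= n].
    case/allpairsP=> -[a b] [] /[swap] + + [E1 E2]; rewrite -{}E1 -{}E2.
    by rewrite mem_iota mem_permutations is_perm_size => /andP[_ ?] /andP[? /eqP].
  move=> [a b] [a' b'] /mem[pa sa lb] /mem[pa' sa' lb'] /= e.
  by have [] := insert_max_inj pa pa' _ _ _ e; rewrite ?sa ?sa' // => -> ->.
move=> w; rewrite mem_permutations is_perm_size; apply/andP/allpairsP => [[pw /eqP sw]|].
  have mw : n.+1 \in w by rewrite perm_mem_range // sw ltn0Sn leqnn.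
  have [u [v e]] : exists u v, w = u ++ n.+1 :: v.
    by case/splitPr: mw => u v; exists u, v.
  have sn : size (u ++ v) = n.
    by move: sw; rewrite e !size_cat /= addnS => -[].
  have puv : is_perm (u ++ v).
    move: pw; rewrite /is_perm sw sn e -cat1s perm_catCA -(addn1 n) iotaD add1n addn1.
    by rewrite perm_sym perm_catC perm_cat2l perm_sym.
  exists (u ++ v, size v); split.
  - by rewrite mem_permutations is_perm_size puv sn eqxx.
  - by rewrite mem_iota /= add0n ltnS -sn size_cat leq_addl.
  by rewrite /= /insert_max size_cat addnK take_size_cat // drop_size_cat // -size_cat sn.
case=> -[a j] [+ _ ->]; rewrite mem_permutations is_perm_size => /andP[pa /eqP sa].
by split; [exact: perm_insert_max | rewrite size_insert_max sa].
Qed.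

Lemma count_sum (T : Type) (a : pred T) (s : seq T) : count a s = \sum_(x <- s) a x.
Proof. by rewrite -sum1_count big_mkcond; apply: eq_bigr => x _; case: (a x). Qed.

(** Removing the maximum from a 321-avoider leaves one whose last [j] entries are
    increasing, where [j] entries followed the maximum.  The last [i.+1] entries of
    the larger permutation are increasing iff [j > i], or [j = 0] and the last [i]
    entries of the smaller one are increasing.  Comparing this for [i.+1] and [i.+2],
    the terms with [j > i.+1] cancel and the term [j = i.+1] is the one with [j = 0]
    for [i.+2]. *)
Lemma tail_count_rec (n i : nat) :
  count (tail_increasing i.+1) (permutations (iota 1 n.+1)) =
  count (tail_increasing i) (permutations (iota 1 n)) +
  count (tail_increasing i.+2) (permutations (iota 1 n.+1)).
Proof.
rewrite !(seq.permP (permutations_insert n)) !count_sum !big_allpairs_dep -big_split /=.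
rewrite !big_seq; apply: eq_bigr => w; rewrite mem_permutations is_perm_size.
case/andP=> pw /eqP sw; rewrite -[0 :: _]/(index_iota 0 n.+1) !big_mkord !big_ord_recl /=.
rewrite !tail_insert_last //.
have tE k : \sum_(j < n) tail_increasing k.+1 (insert_max w (bump 0 j)) =
            \sum_(j < n | k <= j) tail_increasing j.+1 w.
  rewrite [RHS]big_mkcond; apply: eq_bigr => j _.
  by rewrite /bump /= add1n tail_insert ?sw // ltnS; case: leqP.
rewrite !tE; congr addn.
have [le|lt] := ltnP i n; last first.
  have -> : tail_increasing i.+1 w = false by rewrite /tail_increasing sw ltnNge lt.
  rewrite add0n.
  by rewrite !big_pred0 // => j; apply/negbTE; rewrite -ltnNge (leq_trans (ltn_ord j)) // ltnW.
rewrite (bigD1 (Ordinal le)) //=; congr addn; apply: eq_bigl => j.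
by rewrite ltn_neqAle andbC eq_sym.
Qed.

Local Open Scope ring_scope.

Lemma fcoefM (f g : fps int) (n : nat) :
  fcoef (f * g) n = \sum_(i < n.+1) fcoef f i * fcoef g (n - i)%N.
Proof. by []. Qed.

Lemma fcoefD (f g : fps int) (n : nat) : fcoef (f + g) n = fcoef f n + fcoef g n.
Proof. by []. Qed.

Lemma fcoefB (f g : fps int) (n : nat) : fcoef (f - g) n = fcoef f n - fcoef g n.
Proof. by []. Qed.

Lemma fcoefXM (f : fps int) (n : nat) :
  fcoef (fpsX int * f) n = if n is m.+1 then fcoef f m else 0.
Proof.
rewrite fcoefM big_ord_recl /= mul0r add0r; case: n => [|n]; first by rewrite big_ord0.
rewrite big_ord_recl /= mul1r subSS subn0 big1 ?addr0 // => i _.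
by rewrite /= mul0r.
Qed.

Lemma fcoef_gf (c : pred (seq nat)) (n : nat) :
  fcoef (gf c) n = (count c (permutations (iota 1 n)))%:Z.
Proof. by []. Qed.

Lemma tail_gf0 : gf (tail_increasing 0) = 1 + gf (tail_increasing 1).
Proof.
apply: fpsP => -[|n]; rewrite fcoefD !fcoef_gf [fcoef 1 _]/=.
  rewrite /tail_increasing /= (_ : `[< _ >]) //.
  by apply/asboolP; exact: avoids_short.
rewrite add0r; congr Posz; apply: eq_in_count => w.
rewrite mem_permutations is_perm_size /tail_increasing => /andP[_ /eqP sw].
rewrite sw subn0 subn1 /= -sw drop_size; congr andb.
have : size (drop n w) = 1 by rewrite size_drop sw subSnn.
by case: (drop n w) => [|x [|? ?]].
Qed.

Lemma tail_gf_rec (i : nat) : gf (tail_increasing i.+1) =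
  gf (tail_increasing i.+2) + fpsX int * gf (tail_increasing i).
Proof.
apply: fpsP => -[|n]; rewrite fcoefD fcoefXM //.
by rewrite [LHS]/= tail_count_rec PoszD addrC.
Qed.

Lemma tail_gf_low (i n : nat) : (n < i)%N -> fcoef (gf (tail_increasing i)) n = 0.
Proof.
move=> ni /=; rewrite (@eq_in_count _ _ pred0) ?count_pred0 // => w.
rewrite mem_permutations is_perm_size /tail_increasing => /andP[_ /eqP ->].
by rewrite leqNgt ni.
Qed.

(** With [G i] the series of [tail_increasing i] and [C] the Catalan series, this is
    [G i = x^i C^(i+1)].  Both sides, the product and [G i.+1], satisfy the same
    recurrence in [i] with the same initial condition, and start in degree at least
    [i]; these properties force their difference [D] to vanish, by induction on the
    degree and, in a given degree, because [D i] is equal to [D k] for [k] large. *)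
Lemma tail_gf_mul (i : nat) :
  fpsX int * (gf (tail_increasing i) * gf (tail_increasing 0)) = gf (tail_increasing i.+1).
Proof.
pose G i := gf (tail_increasing i); rewrite -/(G i) -/(G 0%N) -/(G i.+1).
pose D i := fpsX int * (G i * G 0%N) - G i.+1.
have recG j : G j.+1 = G j.+2 + fpsX int * G j := tail_gf_rec j.
have recD j : D j.+1 = D j.+2 + fpsX int * D j.
  have e2 : G j.+2 = G j.+1 - fpsX int * G j by rewrite (recG j) addrK.
  have e3 : G j.+3 = G j.+2 - fpsX int * G j.+1 by rewrite (recG j.+1) addrK.
  by rewrite /D e3 e2; ring.
have D0 : D 0%N = D 1%N.
  have G0 : G 0%N = 1 + G 1%N := tail_gf0.
  have e2 : G 2%N = G 1%N - fpsX int * G 0%N by rewrite (recG 0%N) addrK.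
  by rewrite /D e2 G0; ring.
have low j n : (n < j)%N -> fcoef (D j) n = 0.
  move=> nj; rewrite fcoefB tail_gf_low ?(leqW nj) // subr0 fcoefXM.
  case: n nj => // n nj; rewrite fcoefM big1 // => k _.
  rewrite tail_gf_low ?mul0r //; apply: leq_ltn_trans (ltnW nj); exact: leq_ord.
suff D_eq0 n j : fcoef (D j) n = 0.
  by apply/eqP; rewrite -subr_eq0; apply/eqP/fpsP => n; rewrite -/(D i) D_eq0.
elim: n j => [|n IH].
  have h j : fcoef (D j.+1) 0 = 0 by exact: low.
  by case=> // ; rewrite D0.
have step j : fcoef (D j.+1) n.+1 = fcoef (D j.+2) n.+1.
  by rewrite recD fcoefD fcoefXM IH addr0.
have h k j : fcoef (D j.+1) n.+1 = fcoef (D (k + j.+1)%N) n.+1.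
  by elim: k j => // k IHk j; rewrite step IHk addnS.
have h1 j : fcoef (D j.+1) n.+1 = 0.
  by rewrite (h n.+1) low // -addSnnS leq_addr.
by case=> [|j //]; rewrite D0.
Qed.

Lemma catalan_avoid : 1 + gf avoid_cls = 1 + fpsX int * (1 + gf avoid_cls) ^+ 2.
Proof.
have -> : 1 + gf avoid_cls = gf (tail_increasing 0).
  apply: fpsP => -[|n]; rewrite fcoefD !fcoef_gf [fcoef 1 _]/=.
    rewrite /tail_increasing /= (_ : `[< _ >]) //.
    by apply/asboolP; exact: avoids_short.
  rewrite add0r; congr Posz; apply: eq_in_count => w.
  rewrite mem_permutations is_perm_size /tail_increasing => /andP[_ /eqP sw].
  by rewrite subn0 drop_size andbT /avoid_cls /nonempty sw.
by rewrite expr2 tail_gf_mul -tail_gf0.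
Qed.

(** * Substitution of power series and elimination *)

Lemma fps_exp_low (f : fps int) (k n : nat) : fcoef f 0 = 0 -> (n < k)%N ->
  fcoef (f ^+ k) n = 0.
Proof.
move=> f0; elim: k n => // k IH n nk; rewrite exprS fcoefM big1 // => i _.
case: (posnP i) => [->|i0]; first by rewrite f0 mul0r.
by rewrite IH ?mulr0 //; have := ltn_ord i; lia.
Qed.

Lemma fcoef_compE (a f : fps int) (n : nat) :
  fcoef (fps_comp a f) n = \sum_(k < n.+1) fcoef a k * fcoef (f ^+ k) n.
Proof. by []. Qed.

(** Terms of index larger than [n] do not contribute, so the sum defining the
    substitution may be extended. *)
Lemma fcoef_comp (a f : fps int) (n N : nat) : fcoef f 0 = 0 -> (n <= N)%N ->
  fcoef (fps_comp a f) n = \sum_(k < N.+1) fcoef a k * fcoef (f ^+ k) n.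
Proof.
move=> f0 nN; rewrite [LHS]/= -(subnKC nN) -addSn big_split_ord /= [X in _ = _ + X]big1 ?addr0 //.
by move=> i _; rewrite fps_exp_low ?mulr0 // addSn ltnS leq_addr.
Qed.

Lemma fps_comp_add (a b f : fps int) : fps_comp (a + b) f = fps_comp a f + fps_comp b f.
Proof.
by apply: fpsP => n; rewrite fcoefD /= -big_split; apply: eq_bigr => i _; rewrite mulrDl.
Qed.

Lemma fps_comp_sub (a b f : fps int) : fps_comp (a - b) f = fps_comp a f - fps_comp b f.
Proof. by apply/eqP; rewrite eq_sym subr_eq -fps_comp_add subrK. Qed.

Lemma fps_comp_one (f : fps int) : fps_comp 1 f = 1.
Proof.
apply: fpsP => n; rewrite [LHS]/= big_ord_recl mul1r expr0 big1 ?addr0 // => i _.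
by rewrite /= mul0r.
Qed.

Lemma fps_comp_X (f : fps int) : fcoef f 0 = 0 -> fps_comp (fpsX int) f = f.
Proof.
move=> f0; apply: fpsP => n; rewrite (@fcoef_comp _ _ _ n.+1) //.
rewrite big_ord_recl mul0r add0r big_ord_recl mul1r expr1 big1 ?addr0 // => i _.
by rewrite /= mul0r.
Qed.

(** Both sides are the double sum of [a_i b_j f^(i+j)], the terms with [i + j > n] being
    zero in degree [n]. *)
Lemma fps_comp_mul (a b f : fps int) : fcoef f 0 = 0 ->
  fps_comp (a * b) f = fps_comp a f * fps_comp b f.
Proof.
move=> f0; apply: fpsP => n; pose h k := fcoef (f ^+ k) n.
have h0 k : (n < k)%N -> h k = 0 by exact: fps_exp_low.
transitivity (\sum_(i < n.+1) \sum_(j < n.+1) fcoef a i * fcoef b j * h (i + j)%N).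
  rewrite fcoef_compE.
  transitivity (\sum_(k < n.+1) \sum_(i < n.+1 | (i <= k)%N) fcoef a i * fcoef b (k - i)%N * h k).
    apply: eq_bigr => k _; rewrite fcoefM mulr_suml.
    by rewrite (big_ord_widen n.+1 (fun i : nat => fcoef a i * fcoef b (k - i)%N * h k)).
  rewrite (exchange_big_dep xpredT) //=; apply: eq_bigr => i _.
  rewrite -(big_mkord (fun k => (i <= k)%N) (fun k => fcoef a i * fcoef b (k - i)%N * h k)).
  rewrite -(big_mkord xpredT (fun j => fcoef a i * fcoef b j * h (i + j)%N)).
  rewrite (big_cat_nat (n := i)) ?leq0n //=; last by rewrite ltnW.
  rewrite big1_seq ?add0r; last first.
    by move=> k /andP[ik]; rewrite mem_index_iota => /andP[_]; rewrite ltnNge ik.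
  rewrite [RHS](big_cat_nat (n := n.+1 - i)) ?leq_subr //=.
  rewrite [X in _ = _ + X]big1_seq ?addr0; last first.
    move=> j /andP[_]; rewrite mem_index_iota => /andP[lj _]; rewrite h0 ?mulr0 //.
    by move: lj; have := ltn_ord i; lia.
  rewrite -{1}[i : nat]add0n big_addn.
  rewrite (eq_bigl xpredT) => [|j]; last by rewrite leq_addl.
  by apply: eq_bigr => j _; rewrite addnK addnC.
rewrite fcoefM.
transitivity (\sum_(m < n.+1) \sum_(i < n.+1) \sum_(j < n.+1)
    fcoef a i * fcoef b j * (fcoef (f ^+ i) m * fcoef (f ^+ j) (n - m)%N)).
  rewrite [RHS]exchange_big; apply: eq_bigr => i _.
  rewrite [RHS]exchange_big; apply: eq_bigr => j _.
  by rewrite /h exprD fcoefM mulr_sumr.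
apply: eq_bigr => m _; rewrite (@fcoef_comp a f m n) ?leq_ord // (@fcoef_comp b f (n - m) n) ?leq_subr //.
rewrite mulr_suml; apply: eq_bigr => i _; rewrite mulr_sumr; apply: eq_bigr => j _.
by rewrite mulrACA.
Qed.

Lemma fps_comp_exp (a f : fps int) (k : nat) : fcoef f 0 = 0 ->
  fps_comp (a ^+ k) f = fps_comp a f ^+ k.
Proof.
move=> f0; elim: k => [|k IH]; first by rewrite !expr0 fps_comp_one.
by rewrite !exprS fps_comp_mul // IH.
Qed.

Lemma fps_comp_assoc (a b f : fps int) : fcoef b 0 = 0 -> fcoef f 0 = 0 ->
  fps_comp (fps_comp a b) f = fps_comp a (fps_comp b f).
Proof.
move=> b0 f0; apply: fpsP => n; rewrite !fcoef_compE.
transitivity (\sum_(k < n.+1) \sum_(i < n.+1) fcoef a i * (fcoef (b ^+ i) k * fcoef (f ^+ k) n)).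
  apply: eq_bigr => k _; rewrite -[X in X * _]/(fcoef (fps_comp a b) k).
  rewrite (@fcoef_comp a b k n) ?leq_ord // mulr_suml.
  by apply: eq_bigr => i _; rewrite mulrA.
rewrite exchange_big; apply: eq_bigr => i _; rewrite -mulr_sumr -fps_comp_exp //.
Qed.

(** There is one increasing permutation of each positive length. *)
Lemma incr_gf_mul : gf incr_cls * (1 - fpsX int) = fpsX int.
Proof.
have one n : fcoef (gf incr_cls) n = (0 < n)%N%:Z.
  rewrite fcoef_gf (_ : count _ _ = (0 < n)%N) //.
  case: n => [//|n]; rewrite (@eq_in_count _ _ (pred1 (iota 1 n.+1))).
    by rewrite count_uniq_mem ?permutations_uniq // mem_permutations perm_refl.
  move=> w; rewrite mem_permutations => pw /=.
  have uw : uniq w by rewrite (perm_uniq pw) iota_uniq.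
  have sw : size w = n.+1 by rewrite (perm_size pw) size_iota.
  rewrite /incr_cls /nonempty sw /=; apply/asboolP/eqP => [/(increasingP uw)|->].
    rewrite -(sorted_pairwise ltn_trans) => s.
    exact: (irr_sorted_eq ltn_trans ltnn s (iota_ltn_sorted _ _) (perm_mem pw)).
  apply/(increasingP (iota_uniq 1 n.+1)).
  by rewrite -(sorted_pairwise ltn_trans); exact: (iota_ltn_sorted 1 n.+1).
apply: fpsP => n; rewrite mulrBr mulr1 fcoefB mulrC fcoefXM one.
by case: n => [|[|n]]; rewrite ?one.
Qed.

(** The witness is [x / (1 + x)], into which the fractal series will be substituted. *)
Lemma inverse_one_plus_X : exists g : fps int, g * (1 + fpsX int) = fpsX int.
Proof.
exists (FPS (fun n => if n is m.+1 then (-1) ^+ m else 0)).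
apply: fpsP => n; rewrite mulrDr mulr1 fcoefD mulrC fcoefXM.
by case: n => [|[|n]] //=; rewrite exprS mulN1r addNr.
Qed.

(** Writing [p] and [q] for the series of the fractal sums and skew sums, both
    [p (1 + F)] and [q (1 + F)] equal [F^2]. *)
Lemma fractal_functional :
  let x := fpsX int in let F := gf fractal_cls in
  (1 + F) * fps_comp (gf simple_cls) F = F - F ^+ 2 - x * F - x.
Proof.
have alg (F x p q s : fps int) : F = x + p + q + s -> p * (1 + F) = F ^+ 2 ->
    q * (1 + F) = F ^+ 2 -> (1 + F) * s = F - F ^+ 2 - x * F - x.
  move=> e ep eq; have -> : s = F - x - p - q by rewrite e; ring.
  have -> : (1 + F) * (F - x - p - q) =
            (1 + F) * (F - x) - p * (1 + F) - q * (1 + F) by ring.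
  by rewrite ep eq; ring.
have c1 : fractal_cls [:: 1].
  by apply/asboolP/fractal_avoids => //; exact: avoids_short.
have c0 : fractal_cls [::] = false by apply/asboolP => /fractal_perm[].
have part d : gf (fun w => fractal_cls w && decomposableb d w) * (1 + gf fractal_cls)
    = gf fractal_cls ^+ 2.
  have alg2 (F p q : fps int) : F = p + q -> p = q * F -> p * (1 + F) = F ^+ 2.
    by move=> e1 e2; rewrite mulrDr mulr1 {1}e2 -mulrDl addrC -e1 expr2.
  exact: alg2 (gf_split _ _) (fractal_cut_closed d).
apply: alg (part true) (part false).
by rewrite -fractal_indec_gf; exact: gf_decompose.
Qed.

(** The series [I] is that of the sum-indecomposable 321-avoiders.  If [C] is the
    Catalan series, [C (1 - I) = 1] and [C = 1 + x C^2] give [I = x C],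
    hence [I^2 = x (C - 1) = I - x]. *)
Lemma avoid_functional (x := fpsX int) : exists I : fps int,
  I ^+ 2 - I + x = 0 /\
  I = x + gf incr_cls ^+ 2 + fps_comp (gf simple_cls) (gf incr_cls).
Proof.
pose A := gf avoid_cls; exists (gf (indecomposable_in true avoid_cls)); set I := gf _.
have e2 : A = gf (fun w => avoid_cls w && decomposableb true w) + I by exact: gf_split.
have e1 : gf (fun w => avoid_cls w && decomposableb true w) = I * A := avoid_sum_gf.
have C1 : (1 + A) * (1 - I) = 1.
  have -> : (1 + A) * (1 - I) = 1 + A - (I * A + I) by ring.
  by rewrite -e1 -e2 addrK.
have cat : 1 + A = 1 + x * (1 + A) ^+ 2 := catalan_avoid.
set C := 1 + A in C1 cat.
have CI : C * I = C - 1.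
  have -> : C * I = C - C * (1 - I) by ring.
  by rewrite C1.
have Ix : I = x * C.
  have -> : I = C * I * (1 - I) + I * (1 - C * (1 - I)) by ring.
  rewrite C1 subrr mulr0 addr0 CI {1}cat addrC addKr.
  have -> : x * C ^+ 2 * (1 - I) = x * C * (C * (1 - I)) by ring.
  by rewrite C1 mulr1.
split.
  have -> : I ^+ 2 - I + x = I * (I - x * C) + x * (C * I - (C - 1)) - (I - x * C) by ring.
  have I0 : I - x * C = 0 by rewrite {1}Ix subrr.
  by rewrite I0 CI subrr !mulr0 addr0 subr0.
have a1 : avoid_cls [:: 1] by apply/asboolP; exact: avoids_short.
have := @gf_decompose avoid_cls erefl a1.
rewrite avoid_indec_gf avoid_skew_gf -/A {1}e2 -expr2 -/x.
move: (gf (fun w => _ && decomposableb true w)) => p E.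
by apply: (addrI p); rewrite E; ring.
Qed.

Theorem mainTheorem4 :
  let x : fps int := fpsX int in
  let F : fps int := fractal_gf in
  let AiF : fps int := fps_comp irreducible_gf F in
  F ^+ 2 + (AiF - 1 + x) * F + AiF + x = 0
  /\
  F ^+ 6 + (- 2 * x + 3) * F ^+ 4 + (- 2 * x - 1) * F ^+ 3
    + (- 3 * x + 3 + x ^+ 2) * F ^+ 2 + (2 * x ^+ 2 - 1 - 2 * x) * F
    + x + x ^+ 2 = 0.
Proof.
rewrite /= fractal_gfE irreducible_gfE.
have := fractal_functional.
set x := fpsX int; set F := gf fractal_cls; set s := fps_comp _ F => Fs.
split.
  have -> : F ^+ 2 + (s - 1 + x) * F + s + x = (1 + F) * s - (F - F ^+ 2 - x * F - x) by ring.
  by rewrite Fs subrr.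
have F0 : fcoef F 0 = 0.
  by rewrite fcoef_gf /= /fractal_cls; case: asboolP => // /fractal_perm[].
have [g gX] := inverse_one_plus_X.
have [I [I2 IS]] := avoid_functional.
set u := fps_comp g F.
have uF : u * (1 + F) = F.
  have : fps_comp (g * (1 + fpsX int)) F = fps_comp (fpsX int) F by rewrite gX.
  by rewrite fps_comp_mul // fps_comp_add fps_comp_one fps_comp_X.
have u0 : fcoef u 0 = 0.
  have : fcoef (g * (1 + fpsX int)) 0 = 0 by rewrite gX.
  rewrite mulrDr mulr1 fcoefD mulrC fcoefXM addr0 /= => g0.
  by rewrite /u /= big_ord1 g0 mul0r.
have Y0 : fcoef (gf incr_cls) 0 = 0 by [].
(* From y (1 - u) = u and (1 - u) (1 + F) = 1. *)
have yF : fps_comp (gf incr_cls) u = F.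
  have : fps_comp (gf incr_cls * (1 - fpsX int)) u = fps_comp (fpsX int) u.
    by rewrite incr_gf_mul.
  rewrite fps_comp_mul // fps_comp_sub fps_comp_one fps_comp_X // => yu.
  set y := fps_comp _ _ in yu *.
  have -> : y = y * (1 - u) * (1 + F) + y * (u * (1 + F) - F) by ring.
  by rewrite yu uF subrr mulr0 addr0.
pose J := fps_comp I u.
have J2 : J ^+ 2 - J + u = 0.
  have : fps_comp (I ^+ 2 - I + fpsX int) u = fps_comp 0 u by rewrite I2.
  rewrite fps_comp_add fps_comp_sub fps_comp_exp // fps_comp_X // => ->.
  by have := fps_comp_sub 0 0 u; rewrite !subrr.
have JS : J = u + F ^+ 2 + s.
  by rewrite /J IS !fps_comp_add fps_comp_exp // fps_comp_X // fps_comp_assoc // yF.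
(* By the first equation K is (1 + F) J; it does not involve S any more. *)
pose K := (F *+ 2 + F ^+ 3 - x * (1 + F)).
have KJ : K = (1 + F) * J.
  by rewrite JS !mulrDr Fs [_ * u]mulrC uF /K; ring.
have <- : K ^+ 2 - (1 + F) * K + (1 + F) ^+ 2 * u = 0.
  have -> : K ^+ 2 - (1 + F) * K + (1 + F) ^+ 2 * u = (1 + F) ^+ 2 * (J ^+ 2 - J + u).
    by rewrite KJ; ring.
  by rewrite J2 mulr0.
have -> : (1 + F) ^+ 2 * u = (1 + F) * (u * (1 + F)) by ring.
by rewrite uF /K; ring.
Qed.
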